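(* There exist absolute constants $c_0,c_1,c_2\in(0,1)$ such that the following holds. Let $\mathbb{P}$ be a probability distribution on $\mathcal{X}$ and let $\mathcal{F}$ be a convex class of functions $f:\mathcal{X}\to[-1,1]$ containing two functions $f_1,f_2$ with $\|f_1-f_2\|_{\mathbb{P}}\ge1/2$. For all sufficiently large $n$ (with threshold not depending on $f_0$) and every $f_0\in\mathcal{F}$: writing $E(f_0)\ge 0$ for the number with $$E(f_0)^2=\mathbb{E}_{x,\xi}\int(\hat f_n-f_0)^2\,d\mathbb{P},$$ if $E(f_0)^2\le c_0\,\mathcal{W}(\mathcal{F})^2$, then there exists $t(f_0)\ge0$ with $t(f_0)\le c_1E(f_0)$ such that $$c_2\,\mathcal{W}(\mathcal{F})\le\mathcal{W}\big(B_{\mathbb{P}}(f_0,t(f_0))\big)\le\mathcal{W}(\mathcal{F}).$$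
   Context: Model (random design): $X_1,\dots,X_n$ are i.i.d. from $\mathbb{P}$ on $\mathcal{X}$, $\xi_1,\dots,\xi_n$ are i.i.d. $N(0,1)$ independent of the $X_i$, and $Y_i=f_0(X_i)+\xi_i$ with $f_0\in\mathcal{F}$. The least squares estimator (ERM) is $\hat f_n=\Psi\big(\arg\min_{f\in\mathcal{F}}\sum_{i=1}^n(Y_i-f(X_i))^2\big)$, where $\Psi$ is any rule selecting one element of the set of minimizers (minimizers are assumed to exist and all quantities to be measurable). $\mathbb{E}_{x,\xi}$ is expectation over $X_1,\dots,X_n,\xi_1,\dots,\xi_n$. Notation: $\|f\|_{\mathbb{P}}$ is the $L_2(\mathbb{P})$ norm and $B_{\mathbb{P}}(f,r)=\{g\in\mathcal{F}:\|g-f\|_{\mathbb{P}}\le r\}$. For $\mathcal{G}\subseteq\mathcal{F}$, the Gaussian average is $\mathcal{W}(\mathcal{G})=\mathbb{E}_{x,\xi}\sup_{f\in\mathcal{G}}\frac1n\sum_{i=1}^n\xi_if(X_i)$. *)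

(* Defs.v *)
From HB Require Import structures.
From mathcomp Require Import all_boot all_order all_algebra.
From mathcomp Require Import all_classical all_reals all_analysis.

Set Implicit Arguments.
Unset Strict Implicit.
Unset Printing Implicit Defensive.
Import Order.TTheory GRing.Theory Num.Theory.
Import numFieldNormedType.Exports.
Local Open Scope classical_set_scope.
Local Open Scope ring_scope.

Section iid.
Context d (T : measurableType d) (R : realType).

Definition tuple_cons n (z : T * n.-tuple T) : n.+1.-tuple T :=
  [tuple of z.1 :: z.2].

Lemma measurable_tuple_cons n : measurable_fun setT (@tuple_cons n).
Proof. exact: measurable_cons. Qed.

HB.instance Definition _ n :=
  isMeasurableFun.Build _ _ (T * n.-tuple T)%type (n.+1.-tuple T)
    (@tuple_cons n) (@measurable_tuple_cons n).

(* The n-fold product measure P^n, i.e. the joint law of n independent draws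
   from P; [iidE] below is its characterization on boxes. *)
Fixpoint iid (P : probability T R) (n : nat) : probability (n.-tuple T) R :=
  match n with
  | 0 => \d_([tuple] : 0.-tuple T)
  | m.+1 => distribution (P \x iid P m)%E (@tuple_cons m)
  end.

Lemma iidE (P : probability T R) n (A : 'I_n -> set T) :
  (forall i, measurable (A i)) ->
  iid P n [set t | forall i, A i (tnth t i)] = (\prod_(i < n) P (A i))%E.
Proof.
elim: n A => [|n IH] A mA /=.
  by rewrite big_ord0 /dirac indicE mem_set//= => -[].
rewrite big_ord_recl -IH//.
pose B := [set t : n.-tuple T | forall i, A (lift ord0 i) (tnth t i)].
have mB : measurable B.
  rewrite (_ : B = \bigcap_(i in [set: 'I_n])
      ((fun t : n.-tuple T => tnth t i) @^-1` A (lift ord0 i))).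
    apply: fin_bigcap_measurable => // i _.
    by rewrite -[X in measurable X]setTI; exact: measurable_tnth.
  by apply/seteqP; split=> t Bt i; [move=> _; exact: Bt|exact: Bt].
transitivity ((P \x iid P n)%E (A ord0 `*` B)); last exact: product_measure1E.
rewrite /distribution /pushforward; congr (product_measure1 _ _ _).
apply/seteqP; split => -[x t] /=.
  move=> At; split; first by have := At ord0.
  by move=> i; have := At (lift ord0 i); rewrite tnthS.
move=> [/= Ax Bt] i; case: (unliftP ord0 i) => [j|] -> //.
by rewrite tnthS; exact: Bt.
Qed.

End iid.

Section model.
Context d (T : measurableType d) (R : realType).
Implicit Types (P : probability T R) (F G : set (T -> R)) (f g : T -> R).
Implicit Types (Psi : set (T -> R) -> (T -> R)) (n : nat).

(* ((X_1, ..., X_n), (xi_1, ..., xi_n)) *)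
Definition sample n : Type := (n.-tuple T * n.-tuple (measurableTypeR R))%type.

(* E_{x,xi} is the expectation for P^n (x) N(0,1)^n. *)
Definition sample_law P n :
    probability (n.-tuple T * n.-tuple (measurableTypeR R))%type R :=
  (iid P n \x iid (normal_prob 0 1 : probability (measurableTypeR R) R) n)%E.

Definition L2norm P f : \bar R := ('N[P]_2%:E [EFin \o f])%E.

Definition L2ball P F f (r : R) : set (T -> R) :=
  [set g | F g /\ (L2norm P (g \- f)%R <= r%:E)%E].

Definition gaussian_sup G n (z : sample n) : R :=
  sup [set n%:R^-1 * \sum_(i < n) tnth z.2 i * f (tnth z.1 i) | f in G].

(* For the uniformly bounded classes considered the expectation is finite, so
   [fine] loses nothing. *)
Definition gaussian_average P n G : R :=
  fine ('E_(sample_law P n) [@gaussian_sup G n])%E.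

Definition rss n (x : n.-tuple T) (y : n.-tuple R) f : R :=
  \sum_(i < n) (tnth y i - f (tnth x i)) ^+ 2.

Definition argmin_rss F n (x : n.-tuple T) (y : n.-tuple R) : set (T -> R) :=
  [set f | F f /\ forall g, F g -> rss x y f <= rss x y g].

Definition response (f0 : T -> R) n (z : sample n) : n.-tuple R :=
  [tuple f0 (tnth z.1 i) + tnth z.2 i | i < n].

Definition erm Psi F (f0 : T -> R) n (z : sample n) : T -> R :=
  Psi (argmin_rss F z.1 (response f0 z)).

Definition loss P Psi F (f0 : T -> R) n (z : sample n) : R :=
  \int[P]_x ((erm Psi F f0 z x - f0 x) ^+ 2).

Definition risk P Psi F (f0 : T -> R) n : R :=
  fine ('E_(sample_law P n) [@loss P Psi F f0 n])%E.

Definition minimizers_exist F n : Prop :=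
  forall (x : n.-tuple T) (y : n.-tuple R), argmin_rss F x y !=set0.

Definition selects_minimizer Psi F n : Prop :=
  forall (x : n.-tuple T) (y : n.-tuple R),
    argmin_rss F x y !=set0 -> argmin_rss F x y (Psi (argmin_rss F x y)).

Definition class_measurable F : Prop :=
  forall f, F f -> measurable_fun setT f.

Definition gaussian_sup_measurable P F n : Prop :=
  measurable_fun setT (@gaussian_sup F n) /\
  forall f (r : R), F f -> 0 <= r ->
    measurable_fun setT (@gaussian_sup (L2ball P F f r) n).

(* Joint measurability of (data, x) |-> (hat f_n)(x), which makes the iterated
   integral defining [risk] meaningful. *)
Definition erm_measurable Psi F n : Prop :=
  forall f0, F f0 ->
    measurable_fun setT (fun zx : sample n * T => erm Psi F f0 zx.1 zx.2).

End model.

(* Main.v *)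
(* Idea. Write Z = sup_{g in F} <xi, g - f0>_n, so that W(F) = E Z, and let
   h = fhat - f0. Since fhat is the empirical projection of the data on the
   convex class F, Z <= <xi, h>_n + <h, g - h>_n for the maximizing g, hence
   Z <= <xi, h>_n + 2 |h|_{L1(P_n)} because |g - f0| <= 2. Bounding the cross term
   by the empirical L1 norm, not by Cauchy-Schwarz, is the crucial point:
   the absolute value is 1-Lipschitz, so symmetrization and contraction give
   E |h|_{L1(P_n)} <= r + C W(B(f0, r)) on the event |h|_P <= r, whereas the
   empirical L2 norm would only be controlled by sqrt(W(B(f0, r))). With r = C E
   the complementary event has probability at most 1/C^2, and its contribution to
   E Z is absorbed because Var Z <= C/n (Efron-Stein) while W(F) >= c/sqrt n
   (Khintchine, by the two separated functions). As E is much smaller than W(F),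
   this yields W(F) <= C W(B(f0, C E)), and convexity rescales the radius from C E
   to E/2 at the cost of a constant factor. *)
Require Import Defs.
From mathcomp Require Import all_boot all_order all_algebra.
From mathcomp Require Import all_classical all_reals all_analysis.
From mathcomp Require Import measurable_realfun ring lra.
Import Order.TTheory GRing.Theory Num.Theory.
Import numFieldNormedType.Exports.
Set Implicit Arguments.
Unset Strict Implicit.
Unset Printing Implicit Defensive.
Local Open Scope classical_set_scope.
Local Open Scope ring_scope.

(** * Measure-preserving maps *)

(** Two obstacles shape the development. The contraction step for the absolute value is a two-point
    inequality, valid for random signs, whereas the widths are Gaussian; each Gaussian weight is
    therefore replaced by a sign times its mean absolute value, one coordinate at a time, which
    costs a factor [1 / gauss_abs]. Moreover only the suprema of the linear Gaussian process over
    [F] and over its balls are assumed measurable. Suprema of the absolute process are handled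
    pointwise in the design, inside a finite average over signs, and are dominated by [rad], which
    is [cproc] evaluated at noise with values plus or minus one and so inherits measurability.

    The process is always centered at a member of the class. Its suprema are then nonnegative, so
    almost every integral is one of a nonnegative function and needs only Tonelli; this is why
    [measure_preserving] tests against nonnegative functions.

    The lower bound on the global width is used to turn the variance bound, of order 1/n, into a
    multiple of the squared width. Only after this does the contribution of the bad event become a
    fraction of the width itself. *)

Definition measure_preserving {d1 d2} {A : measurableType d1}
    {B : measurableType d2} {R : realType} (mu : {measure set A -> \bar R})
    (nu : {measure set B -> \bar R}) (phi : A -> B) :=
  measurable_fun setT phi /\
  forall f : B -> \bar R, measurable_fun setT f -> (forall b, 0 <= f b)%E ->
    (\int[mu]_a f (phi a) = \int[nu]_b f b)%E.

Definition pprod {d1 d2} {A : measurableType d1} {B : measurableType d2}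
    {R : realType} (mu : probability A R) (nu : probability B R) :
  probability (A * B)%type R := (mu \x nu)%E.

Section measure_preserving.
Context {R : realType}.

Lemma integral_prob_cst {d} {A : measurableType d} (P : probability A R)
    (r : \bar R) : (\int[P]_x r = r)%E.
Proof.
rewrite (integral_cst P)// -[RHS]mule1; congr (_ * _)%E.
exact: probability_setT.
Qed.

Lemma measure_preserving_comp {d1 d2 d3} {A : measurableType d1}
    {B : measurableType d2} {C : measurableType d3}
    (mu : {measure set A -> \bar R}) (nu : {measure set B -> \bar R})
    (la : {measure set C -> \bar R}) (phi : A -> B) (psi : B -> C) :
  measure_preserving mu nu phi -> measure_preserving nu la psi ->
  measure_preserving mu la (psi \o phi).
Proof.
move=> [mphi iphi] [mpsi ipsi]; split; first exact: measurableT_comp.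
move=> f mf f0; rewrite -ipsi// -(iphi (f \o psi))//=.
exact: measurableT_comp.
Qed.

(** With [phi := tuple_cons], a claim about [iid P n.+1] can be checked on [pprod P (iid P n)],
    where the map splits into a head and a tail. The inductions on the sample size below rest on
    this. *)
Lemma measure_preserving_cancel {d1 d2 d3} {A : measurableType d1}
    {B : measurableType d2} {C : measurableType d3}
    (mu : {measure set A -> \bar R}) (nu : {measure set B -> \bar R})
    (la : {measure set C -> \bar R}) (phi : A -> B) (psi : B -> C) :
  measurable_fun setT psi ->
  measure_preserving mu nu phi -> measure_preserving mu la (psi \o phi) ->
  measure_preserving nu la psi.
Proof.
move=> mpsi [mphi iphi] [_ ipsi]; split => // f mf f0.
rewrite -ipsi// -(iphi (f \o psi))//=; exact: measurableT_comp.
Qed.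

Lemma measure_preserving_id {d} {A : measurableType d}
    (mu : {measure set A -> \bar R}) : measure_preserving mu mu idfun.
Proof. by split=> //; exact: measurable_id. Qed.

Lemma measure_preserving_integral {d1 d2} {A : measurableType d1}
    {B : measurableType d2} (mu : {measure set A -> \bar R})
    (nu : {measure set B -> \bar R}) (phi : A -> B) (f : B -> \bar R) :
  measure_preserving mu nu phi -> measurable_fun setT f ->
  (\int[mu]_a f (phi a) = \int[nu]_b f b)%E.
Proof.
move=> [mphi iphi] mf; rewrite integralE [RHS]integralE.
have := iphi f^\+%E; have := iphi f^\-%E.
move=> /(_ (measurable_funeneg mf)) hn /(_ (measurable_funepos mf)) hp.
rewrite -hn; last by move=> b; exact: funeneg_ge0.
rewrite -hp; last by move=> b; exact: funepos_ge0.
by congr (_ - _)%E; apply: eq_integral => a _; rewrite ?funeposE ?funenegE.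
Qed.

Section prod.
Context {d1 d2 d3 d4} {A : measurableType d1} {B : measurableType d2}
  {C : measurableType d3} {D : measurableType d4}.
Variables (mu : probability A R) (nu : probability B R)
  (la : probability C R) (ka : probability D R).

Lemma measure_preserving_fst : measure_preserving (pprod mu nu) mu fst.
Proof.
split=> // f mf f0; rewrite fubini_tonelli1//=; last exact: measurableT_comp.
apply: eq_integral => a _; rewrite /fubini_F/=.
exact: integral_prob_cst.
Qed.

Lemma measure_preserving_swap :
  measure_preserving (pprod mu nu) (pprod nu mu) (fun z => (z.2, z.1)).
Proof.
have msw : measurable_fun [set: A * B] (fun z => (z.2, z.1)).
  exact: measurable_fun_pair.
split=> // f mf f0.
rewrite (fubini_tonelli1 (f \o (fun z => (z.2, z.1))))//=; last first.
  exact: measurableT_comp.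
by rewrite fubini_tonelli2.
Qed.

Lemma measure_preserving_prod (phi : A -> C) (psi : B -> D) :
  measure_preserving mu la phi -> measure_preserving nu ka psi ->
  measure_preserving (pprod mu nu) (pprod la ka) (fun z => (phi z.1, psi z.2)).
Proof.
move=> [mphi iphi] [mpsi ipsi].
have m1 : measurable_fun [set: A * B] (fun z => (phi z.1, psi z.2)).
  by apply: measurable_fun_pair; exact: measurableT_comp.
split=> // f mf f0; rewrite (fubini_tonelli1 f)//.
rewrite (fubini_tonelli1 (f \o (fun z => (phi z.1, psi z.2))))//=; last first.
  exact: measurableT_comp.
rewrite -iphi//.
- apply: eq_integral => a _; rewrite /fubini_F/=.
  rewrite (ipsi (fun b => f (phi a, b)))//.
  exact: measurableT_comp.
- exact: measurable_fun_fubini_tonelli_F.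
- by move=> b; apply: integral_ge0.
Qed.

Lemma measure_preserving_assoc :
  measure_preserving (pprod (pprod mu nu) la) (pprod mu (pprod nu la))
    (fun z => (z.1.1, (z.1.2, z.2))).
Proof.
have m1 : measurable_fun [set: A * B * C] (fun z => (z.1.1, (z.1.2, z.2))).
  apply: measurable_fun_pair; first exact: measurableT_comp.
  by apply: measurable_fun_pair => //; exact: measurableT_comp.
split=> // f mf f0.
rewrite (fubini_tonelli1 (f \o (fun z => (z.1.1, (z.1.2, z.2)))))//=; last first.
  exact: measurableT_comp.
rewrite fubini_tonelli1//; last first.
- by move=> b; apply: integral_ge0 => c _; exact: f0.
- by apply: measurable_fun_fubini_tonelli_F => //=; exact: measurableT_comp mf m1.
have -> := fubini_tonelli1 (m1 := mu) (m2 := pprod nu la) f mf f0.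
apply: eq_integral => a _; rewrite /fubini_F/=.
rewrite (fubini_tonelli1 (fun y => f (a, y)))//; exact: measurableT_comp.
Qed.

End prod.
End measure_preserving.

(** * Averages over signs: contraction and Khintchine *)

Section indexed_sup.
Context {R : realType} {J : Type}.
Implicit Types (A : set J) (c f g w : J -> R).

Lemma isup_ub A f M j : (forall k, A k -> f k <= M) -> A j ->
  f j <= sup [set f k | k in A].
Proof.
move=> fM Aj; apply: ub_le_sup; last by exists j.
by exists M => _ [k Ak <-]; exact: fM.
Qed.

Lemma isup_le A f m j : A j -> (forall k, A k -> f k <= m) ->
  sup [set f k | k in A] <= m.
Proof.
move=> Aj fm; apply: ge_sup; first by exists (f j); exists j.
by move=> _ [k Ak <-]; exact: fm.
Qed.

(** The two-point contraction inequality. For indices k and l the sign of [w k] decides how they are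
    paired on the right: if [w k >= 0], take k in the first supremum and l in the second, otherwise
    exchange them; in both cases [- |w l|] is at most the term it is replaced by. *)
Lemma isup_norm_sum_le A c w M j : A j ->
  (forall k, A k -> `|c k| <= M) -> (forall k, A k -> `|w k| <= M) ->
  sup [set c k + `|w k| | k in A] + sup [set c k - `|w k| | k in A] <=
  sup [set c k + w k | k in A] + sup [set c k - w k | k in A].
Proof.
move=> Aj cM wM.
have pM k : A k -> c k + w k <= M + M.
  by move=> Ak; apply: lerD; apply: le_trans (ler_norm _) _; auto.
have nM k : A k -> c k - w k <= M + M.
  move=> Ak; apply: lerD; apply: le_trans (ler_norm _) _; auto.
  by rewrite normrN; auto.
rewrite -lerBrDr; apply: (isup_le Aj) => k Ak.
rewrite lerBrDr addrC -lerBrDr; apply: (isup_le Aj) => l Al.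
have hk1 := isup_ub pM Ak; have hk2 := isup_ub nM Ak.
have hl1 := isup_ub pM Al; have hl2 := isup_ub nM Al.
by case: (ger0P (w k)) => hk; case: (ger0P (w l)) => hl; lra.
Qed.

End indexed_sup.

Section sign_average.
Context {R : realType}.

(** The expectation over n independent fair signs. Recursion on the first sign makes conditioning on
    it a definitional step in every induction. *)
Fixpoint savg n : (n.-tuple bool -> R) -> R :=
  match n with
  | 0 => fun F => F [tuple]
  | m.+1 => fun F => (savg (fun e => F [tuple of false :: e]) +
                      savg (fun e => F [tuple of true :: e])) / 2
  end.

Lemma le_savg n (F G : n.-tuple bool -> R) :
  (forall e, F e <= G e) -> savg F <= savg G.
Proof.
elim: n F G => [|n IH] F G FG /=; first exact: FG.
by rewrite ler_pM2r ?invr_gt0// lerD// IH.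
Qed.

Lemma eq_savg n (F G : n.-tuple bool -> R) : F =1 G -> savg F = savg G.
Proof. by move=> /funext ->. Qed.

Lemma savgD n (F G : n.-tuple bool -> R) :
  savg (fun e => F e + G e) = savg F + savg G.
Proof. by elim: n F G => [|n IH] F G //=; rewrite !IH; field. Qed.

Lemma savgZ n (c : R) (F : n.-tuple bool -> R) :
  savg (fun e => c * F e) = c * savg F.
Proof. by elim: n F => [|n IH] F //=; rewrite !IH; field. Qed.

Lemma savg_cst n (c : R) : savg (fun _ : n.-tuple bool => c) = c.
Proof. by elim: n => [|n IH] //=; rewrite !IH; field. Qed.

Lemma savg_negb n (F : n.-tuple bool -> R) :
  savg (fun e => F (map_tuple negb e)) = savg F.
Proof.
elim: n F => [|n IH] F /=; first by congr F; exact: val_inj.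
rewrite addrC; congr ((_ + _) / 2).
- rewrite -(IH (fun e => F [tuple of false :: e])).
  by apply: eq_savg => e; congr F; exact: val_inj.
- rewrite -(IH (fun e => F [tuple of true :: e])).
  by apply: eq_savg => e; congr F; exact: val_inj.
Qed.

Definition sgb (b : bool) : R := (-1) ^+ b.

Lemma sgbF : sgb false = 1. Proof. by []. Qed.
Lemma sgbT : sgb true = -1. Proof. by rewrite /sgb expr1. Qed.

Lemma sgbN b : sgb (~~ b) = - sgb b.
Proof. by case: b; rewrite ?sgbF ?sgbT ?opprK. Qed.

Lemma sum_sgb_cons n b (e : n.-tuple bool) (v : 'I_n.+1 -> R) :
  \sum_(i < n.+1) sgb (tnth [tuple of b :: e] i) * v i =
  sgb b * v ord0 + \sum_(i < n) sgb (tnth e i) * v (lift ord0 i).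
Proof.
by rewrite big_ord_recl tnth0; under eq_bigr do rewrite tnthS.
Qed.

(** The offset [a] is there for the induction: once the first sign is fixed, its term depends on the
    index only and joins the offset. *)
Lemma savg_contraction (J : Type) (A : set J) n (a : J -> R)
    (v : J -> 'I_n -> R) j :
  A j -> (exists M, forall k, A k -> `|a k| <= M) ->
  (exists M, forall k i, A k -> `|v k i| <= M) ->
  savg (fun e => sup [set a k + \sum_(i < n) sgb (tnth e i) * `|v k i|
                     | k in A]) <=
  savg (fun e => sup [set a k + \sum_(i < n) sgb (tnth e i) * v k i
                     | k in A]).
Proof.
move=> Aj; elim: n a v => [|n IH] a v [Ma aM] [Mv vM].
  rewrite /= le_eqVlt; apply/orP; left; apply/eqP; congr sup.
  by apply/seteqP; split=> _ [k Ak <-]; exists k => //; rewrite !big_ord0.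
pose v' k i := v k (lift ord0 i).
(* For a fixed first sign, [c] is plus or minus the absolute value of the first coordinate, and the
   induction hypothesis clears the absolute values of the others. The remaining one is cleared by
   [isup_norm_sum_le], which compares the two first signs jointly. *)
have step (c : J -> R) : (exists M, forall k, A k -> `|c k| <= M) ->
    savg (fun e : n.-tuple bool => sup [set a k + c k +
      \sum_(i < n) sgb (tnth e i) * `|v' k i| | k in A]) <=
    savg (fun e : n.-tuple bool => sup [set a k + c k +
      \sum_(i < n) sgb (tnth e i) * v' k i | k in A]).
  move=> [Mc cM]; apply: (IH (fun k => a k + c k) v').
    exists (Ma + Mc) => k Ak; apply: le_trans (ler_normD _ _) _.
    by apply: lerD; auto.
  by exists Mv => k i; exact: vM.
rewrite /= ler_pM2r ?invr_gt0//.
under eq_savg do under eq_imagel do rewrite sum_sgb_cons sgbF mul1r addrA.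
under [X in _ + X <= _]eq_savg do
  under eq_imagel do rewrite sum_sgb_cons sgbT mulN1r addrA.
under [X in _ <= X + _]eq_savg do
  under eq_imagel do rewrite sum_sgb_cons sgbF mul1r addrA.
under [X in _ <= _ + X]eq_savg do
  under eq_imagel do rewrite sum_sgb_cons sgbT mulN1r addrA.
apply: le_trans (lerD (step _ _) (step _ _)) _.
- by exists Mv => k Ak; rewrite normr_id; exact: vM.
- by exists Mv => k Ak; rewrite normrN normr_id; exact: vM.
rewrite -!savgD; apply: le_savg => e.
pose c k := a k + \sum_(i < n) sgb (tnth e i) * v' k i.
have E (w : J -> R) : [set a k + w k + \sum_(i < n) sgb (tnth e i) * v' k i
    | k in A] = [set c k + w k | k in A].
  by apply: eq_imagel => k _; rewrite /c addrAC.
rewrite !E.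
apply: (@isup_norm_sum_le _ _ _ _ _ (Ma + n%:R * Mv + Mv) _ Aj) => k Ak.
  have Mv0 : 0 <= Mv by apply: le_trans (vM k ord0 Ak).
  rewrite /c; apply: le_trans (ler_normD _ _) _.
  rewrite -addrA lerD//; first exact: aM.
  rewrite -[leLHS]addr0 lerD//; apply: le_trans (ler_norm_sum _ _ _) _.
  rewrite -[n in n%:R]card_ord mulr_natl -sumr_const ler_sum// => i _.
  by rewrite normrM /sgb normr_sign mul1r; exact: vM.
have Ma0 : 0 <= Ma by apply: le_trans (aM k Ak).
have Mv0 : 0 <= Mv by apply: le_trans (vM k ord0 Ak).
apply: le_trans (vM _ _ Ak) _; rewrite lerDr addr_ge0// mulr_ge0//.
Qed.

Lemma savg_sum_sq n (s : R) (v : 'I_n -> R) :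
  savg (fun e => (s + \sum_(i < n) sgb (tnth e i) * v i) ^+ 2) =
  s ^+ 2 + \sum_(i < n) v i ^+ 2.
Proof.
elim: n s v => [|n IH] s v /=; first by rewrite !big_ord0 !addr0.
under eq_savg do rewrite sum_sgb_cons addrA.
under [X in _ + X]eq_savg do rewrite sum_sgb_cons addrA.
by rewrite !IH big_ord_recl sgbF sgbT; field.
Qed.

Lemma savg_sum_pow4 n (s : R) (v : 'I_n -> R) :
  savg (fun e => (s + \sum_(i < n) sgb (tnth e i) * v i) ^+ 4) <=
  s ^+ 4 + 6 * s ^+ 2 * (\sum_(i < n) v i ^+ 2) +
    3 * (\sum_(i < n) v i ^+ 2) ^+ 2.
Proof.
elim: n s v => [|n IH] s v /=.
  by rewrite !big_ord0 !addr0 expr0n/= !mulr0 !addr0.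
under eq_savg do rewrite sum_sgb_cons addrA.
under [X in _ + X]eq_savg do rewrite sum_sgb_cons addrA.
apply: le_trans (ler_wpM2r _ (lerD (IH _ _) (IH _ _))) _.
  by rewrite invr_ge0.
rewrite big_ord_recl sgbF sgbT; set S := \sum_(i < n) _.
rewrite -subr_ge0.
(* The exact fourth moment has a further term [- 2 * v i ^+ 4] for each coordinate; dropping it is
   the only loss. *)
rewrite (_ : _ - _ = 2 * v ord0 ^+ 4); last by field.
by rewrite mulr_ge0// exprn_even_ge0.
Qed.

(** A minorant of the absolute value by even powers turns the second and fourth moments of a sign
    sum into a lower bound on its first absolute moment. *)
Lemma norm_ge_quartic (y t : R) : 0 < t ->
  y ^+ 2 / t - y ^+ 4 / (4 * t ^+ 3) <= `|y|.
Proof.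
move=> t0; pose z := `|y| / t.
have z0 : 0 <= z by rewrite divr_ge0// ltW.
have yE : `|y| = z * t by rewrite /z divfK// gt_eqF.
have -> : y ^+ 2 = (z * t) ^+ 2 by rewrite -yE real_normK// num_real.
have -> : y ^+ 4 = (z * t) ^+ 4.
  by rewrite -yE -[4%N]/(2 * 2)%N !exprM real_normK// num_real.
rewrite yE -subr_ge0.
rewrite (_ : _ - _ = t * (z * (1 - z + z ^+ 3 / 4))); last first.
  by field; rewrite gt_eqF.
rewrite mulr_ge0 ?(ltW t0)// mulr_ge0//.
(* This product is [z ^+ 3] minus its tangent at 6/5, a rational point close to the minimizer 2/sqrt
   3 of [1 - z + z ^+ 3 / 4]. *)
have : 0 <= (z - 6 / 5) ^+ 2 * (z + 12 / 5) by rewrite mulr_ge0 ?sqr_ge0//; lra.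
by nra.
Qed.

(** A form of Khintchine's inequality without a square root. With [t] of order sqrt n and bounded
    [v], the right choice of [t] makes the bound linear in the sum of squares, so that it can later
    be integrated over the design. *)
Lemma savg_norm_ge n (t : R) (v : 'I_n -> R) : 0 < t ->
  (\sum_(i < n) v i ^+ 2) / t -
    3 * (\sum_(i < n) v i ^+ 2) ^+ 2 / (4 * t ^+ 3) <=
  savg (fun e => `|\sum_(i < n) sgb (tnth e i) * v i|).
Proof.
move=> t0; set S := \sum_(i < n) v i ^+ 2.
apply: (@le_trans _ _ (savg (fun e =>
    t^-1 * (0 + \sum_(i < n) sgb (tnth e i) * v i) ^+ 2 +
    (- (4 * t ^+ 3)^-1) * (0 + \sum_(i < n) sgb (tnth e i) * v i) ^+ 4))).
  rewrite savgD !savgZ savg_sum_sq expr0n add0r -/S mulrC lerD2l//.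
  have := savg_sum_pow4 0 v; rewrite -/S !expr0n /= mulr0 mul0r !add0r => h.
  rewrite mulNr lerN2 mulrC ler_wpM2r//.
  by rewrite invr_ge0 mulr_ge0// exprn_ge0// ltW.
apply: le_savg => e; rewrite add0r mulNr mulrC [X in _ - X]mulrC.
exact: norm_ge_quartic.
Qed.

End sign_average.

(** * The standard normal law *)

Section gauss.
Context {R : realType}.
Local Notation mu := (@lebesgue_measure R).

Definition gauss : probability (measurableTypeR R) R := normal_prob 0 1.

Lemma normal_pdfN (x : R) : normal_pdf 0 1 (- x) = normal_pdf 0 1 x.
Proof.
by rewrite normal_pdfE ?oner_neq0// /normal_fun !subr0 sqrrN.
Qed.

Lemma gaussN (A : set (measurableTypeR R)) : measurable A ->
  gauss (-%R @^-1` A) = gauss A.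
Proof.
move=> mA; rewrite /gauss /= /normal_prob.
have mN : measurable_fun [set: measurableTypeR R] (-%R : _ -> measurableTypeR R).
  exact: oppr_measurable.
have mp : measurable_fun A (fun x => (normal_pdf 0 1 x)%:E).
  by apply/measurable_funTS/measurable_EFinP; exact: measurable_normal_pdf.
transitivity (\int[pushforward mu (-%R : measurableTypeR R -> measurableTypeR R)]_(x in A)
    (normal_pdf 0 1 x)%:E)%E.
  rewrite (ge0_integral_pushforward mN)//; last first.
    by move=> x _; rewrite lee_fin normal_pdf_ge0.
  by apply: eq_integral => x _ /=; rewrite normal_pdfN.
by apply: eq_measure_integral => B mB _; exact: lebesgue_measureN.
Qed.

Lemma measure_preserving_gaussN :
  measure_preserving gauss gauss (-%R : measurableTypeR R -> measurableTypeR R).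
Proof.
have mN : measurable_fun [set: measurableTypeR R] (-%R : _ -> measurableTypeR R).
  exact: oppr_measurable.
split=> // f mf f0.
have := ge0_integral_pushforward mN gauss measurableT mf.
rewrite preimage_setT => <-; last by move=> x _; exact: f0.
by apply: eq_measure_integral => B mB _; exact: gaussN.
Qed.

(** The normal law is given through its values on sets. Its Radon-Nikodym derivative has the same
    integral as [normal_pdf] over every measurable set, hence agrees with it almost everywhere. *)
Lemma ge0_integral_gauss (f : measurableTypeR R -> \bar R) :
  measurable_fun setT f -> (forall x, 0 <= f x)%E ->
  (\int[gauss]_x f x = \int[mu]_x (f x * (normal_pdf 0 1 x)%:E))%E.
Proof.
move=> mf f0.
have dom : gauss `<< mu := normal_prob_dominates 0 1.
rewrite -(Radon_Nikodym_SigmaFinite.change_of_variables dom f0 measurableT mf).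
pose g := Radon_Nikodym_SigmaFinite.f gauss mu.
have gi : mu.-integrable setT g := Radon_Nikodym_SigmaFinite.f_integrable dom.
have mp : measurable_fun [set: measurableTypeR R] (fun x => (normal_pdf 0 1 x)%:E).
  by apply/measurable_EFinP; exact: measurable_normal_pdf.
apply: ae_eq_integral => //.
- by apply: emeasurable_funM => //; exact: (measurable_int mu).
- exact: emeasurable_funM.
apply: ae_eqe_mul2l; apply: integral_ae_eq => //.
move=> E _ mE.
by rewrite -(Radon_Nikodym_SigmaFinite.f_integral dom).
Qed.

(** The integrand is dominated by a multiple of the normal density with standard deviation sqrt 2,
    whose integral is 1: with [y = x ^+ 2], the bound [y * expR (- y / 4) <= 4] follows from
    [1 + y / 4 <= expR (y / 4)]. *)
Lemma gauss_sqr_lty : (\int[gauss]_x (x ^+ 2)%:E < +oo)%E.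
Proof.
have msq : measurable_fun [set: measurableTypeR R] (fun x => (x ^+ 2)%:E).
  by apply/measurable_EFinP; exact: measurable_funX.
rewrite ge0_integral_gauss//; last by move=> x; rewrite lee_fin sqr_ge0.
pose s : R := Num.sqrt 2.
have s0 : s != 0 by rewrite gt_eqF// sqrtr_gt0.
pose c := 4 * normal_peak 1 / normal_peak s.
have mpdf : measurable_fun [set: measurableTypeR R]
    (fun x => (normal_pdf 0 s x)%:E).
  by apply/measurable_EFinP; exact: measurable_normal_pdf.
have c0 : 0 <= c by rewrite divr_ge0 ?mulr_ge0 ?normal_peak_ge0.
apply: (@le_lt_trans _ _ (\int[mu]_x (c%:E * (normal_pdf 0 s x)%:E))%E).
  apply: ge0_le_integral => //.
  - by move=> x _; rewrite -EFinM lee_fin mulr_ge0 ?sqr_ge0 ?normal_pdf_ge0.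
  - apply: emeasurable_funM => //; apply/measurable_EFinP.
    exact: measurable_normal_pdf.
  - exact: measurable_funeM.
  move=> x _; rewrite -!EFinM lee_fin !normal_pdfE ?oner_neq0//.
  rewrite /c.
  rewrite [leRHS](_ : _ = normal_peak 1 * (4 * normal_fun 0 s x)); last first.
    by field; rewrite gt_eqF// normal_peak_gt0.
  rewrite mulrCA ler_wpM2l ?normal_peak_ge0// /normal_fun !subr0 expr1n.
  rewrite sqr_sqrtr//; set y := x ^+ 2.
  have -> : - y / (1 *+ 2) = - (y / 4) + - y / (2 *+ 2).
    have -> : 2 *+ 2 = 4 :> R by rewrite -mulrnA.
    by have -> : 1 *+ 2 = 2 :> R by []; lra.
  rewrite expRD mulrA ler_wpM2r ?expR_ge0// expRN -ler_pdivlMr ?invr_gt0 ?expR_gt0//.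
  rewrite invrK; have := expR_ge1Dx (y / 4); lra.
rewrite ge0_integralZl//=; last by move=> x _; rewrite lee_fin normal_pdf_ge0.
by rewrite integral_normal_pdf mule1 ltry.
Qed.

(** Both moments are carried as symbols (their values are 1 and sqrt(2/pi)). The final constants are
    built from finiteness of the second moment and positivity of the first absolute one. *)
Definition gauss_var : R := fine (\int[gauss]_x (x ^+ 2)%:E).
Definition gauss_abs : R := fine (\int[gauss]_x (`|x|)%:E).

Lemma gauss_varE : (\int[gauss]_x (x ^+ 2)%:E = gauss_var%:E)%E.
Proof.
rewrite fineK// ge0_fin_numE ?gauss_sqr_lty//.
by apply: integral_ge0 => x _; rewrite lee_fin sqr_ge0.
Qed.

Lemma gauss_var_ge0 : 0 <= gauss_var.
Proof. by rewrite fine_ge0// integral_ge0// => x _; rewrite lee_fin sqr_ge0. Qed.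

Lemma gauss_absE : (\int[gauss]_x (`|x|)%:E = gauss_abs%:E)%E.
Proof.
have i0 : (0 <= \int[gauss]_x (`|x|)%:E)%E.
  by apply: integral_ge0 => x _; rewrite lee_fin.
rewrite fineK// ge0_fin_numE//.
apply: (@le_lt_trans _ _ (\int[gauss]_x (1 + (x ^+ 2)%:E))%E).
  apply: ge0_le_integral => //.
  - by apply/measurable_EFinP; exact: normr_measurable.
  - by apply: emeasurable_funD => //; apply/measurable_EFinP; exact: measurable_funX.
  - move=> x _; rewrite -EFinD lee_fin -(real_normK (num_real x)).
    set y := `|x|; have : 0 <= (y - 1 / 2) ^+ 2 by exact: sqr_ge0.
    by nra.
rewrite ge0_integralD//=; last 2 first.
- by move=> x _; rewrite lee_fin sqr_ge0.
- by apply/measurable_EFinP; exact: measurable_funX.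
by rewrite gauss_varE integral_prob_cst -EFinD ltry.
Qed.

(** Otherwise the law would be carried by the point 0, which is null because the law is dominated by
    Lebesgue measure. *)
Lemma gauss_abs_gt0 : 0 < gauss_abs.
Proof.
have i0 : (0 <= \int[gauss]_x (`|x|)%:E)%E.
  by apply: integral_ge0 => x _; rewrite lee_fin.
rewrite lt_neqAle fine_ge0// andbT eq_sym; apply/negP => /eqP h.
have mabs : measurable_fun [set: measurableTypeR R] (fun x => (`|x|)%:E).
  by apply/measurable_EFinP; exact: normr_measurable.
have h0 : (\int[gauss]_x `|(`|x|)%:E| = 0)%E.
  under eq_integral do rewrite /= normr_id.
  by rewrite gauss_absE h.
have /(ae_eq_integral_abs gauss measurableT mabs) := h0.
move=> [B [mB B0 sB]].
have sub : ~` [set 0 : measurableTypeR R] `<=` B.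
  move=> x x0; apply: sB => /= /(_ I) [] /eqP; rewrite normr_eq0 => /eqP.
  exact: x0.
have m1 : measurable ([set 0] : set (measurableTypeR R)) by exact: measurable_set1.
have z0 : gauss [set 0] = 0%E.
  have /null_content_dominatesP := @normal_prob_dominates R 0 1.
  by apply => //; exact: lebesgue_measure_set1.
have : (gauss [set: measurableTypeR R] <= gauss [set 0%R] + gauss B)%E.
  rewrite -[leRHS]addr0.
  apply: (@le_trans _ _ (gauss ([set 0%R] `|` B))).
    apply: le_measure; rewrite ?inE//; first exact: measurableU.
    by move=> x _; case: (eqVneq x 0) => [->|x0]; [left|right; apply: sub => /eqP; exact/negP].
  by rewrite addr0; apply: measureU2.
have -> : gauss [set: measurableTypeR R] = 1%E by exact: probability_setT.
rewrite z0 B0 adde0.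
by rewrite lee_fin ler10.
Qed.

End gauss.

(** * Rearranging the factors of product measures *)

Section measure_preserving2.
Context {R : realType}.

Lemma measure_preserving_inv {d1 d2} {A : measurableType d1}
    {B : measurableType d2} (mu : {measure set A -> \bar R})
    (nu : {measure set B -> \bar R}) (phi : A -> B) (psi : B -> A) :
  measurable_fun setT psi -> cancel phi psi ->
  measure_preserving mu nu phi -> measure_preserving nu mu psi.
Proof.
move=> mpsi phiK [mphi iphi]; split => // f mf f0.
rewrite -(iphi (f \o psi))//=; last exact: measurableT_comp.
by under eq_integral do rewrite phiK.
Qed.

Context {d1 d2 d3 d4} {A : measurableType d1} {B : measurableType d2}
  {C : measurableType d3} {D : measurableType d4}.
Variables (mu : probability A R) (nu : probability B R)
  (la : probability C R) (ka : probability D R).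

Lemma measure_preserving_snd : measure_preserving (pprod mu nu) nu snd.
Proof.
exact: measure_preserving_comp (measure_preserving_swap _ _)
  (measure_preserving_fst _ _).
Qed.

Lemma measure_preserving_assocV :
  measure_preserving (pprod mu (pprod nu la)) (pprod (pprod mu nu) la)
    (fun z => ((z.1, z.2.1), z.2.2)).
Proof.
apply: (measure_preserving_inv (phi := fun z => (z.1.1, (z.1.2, z.2)))).
- apply: measurable_fun_pair; last exact: measurableT_comp.
  by apply: measurable_fun_pair => //; exact: measurableT_comp.
- by move=> [[]].
- exact: measure_preserving_assoc.
Qed.

End measure_preserving2.

Section exchange.
Context {R : realType} {d1 d2 d3 d4} {A : measurableType d1} {B : measurableType d2}
  {C : measurableType d3} {D : measurableType d4}.
Variables (mu : probability A R) (nu : probability B R)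
  (la : probability C R) (ka : probability D R).

(** Regroups two independent pairs coordinate by coordinate. Applied to two copies of a sample, it
    allows exchanging one component of the copies while leaving the other alone. *)
Lemma measure_preserving_exchange :
  measure_preserving (pprod (pprod mu nu) (pprod la ka))
    (pprod (pprod mu la) (pprod nu ka))
    (fun z => ((z.1.1, z.2.1), (z.1.2, z.2.2))).
Proof.
have h1 := measure_preserving_assoc mu nu (pprod la ka).
have h2 := measure_preserving_prod (measure_preserving_id mu)
  (measure_preserving_assocV nu la ka).
have h3 := measure_preserving_prod (measure_preserving_id mu)
  (measure_preserving_prod (measure_preserving_swap nu la)
    (measure_preserving_id ka)).
have h4 := measure_preserving_prod (measure_preserving_id mu)
  (measure_preserving_assoc la nu ka).
have h5 := measure_preserving_assocV mu la (pprod nu ka).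
exact: measure_preserving_comp (measure_preserving_comp
  (measure_preserving_comp (measure_preserving_comp h1 h2) h3) h4) h5.
Qed.

End exchange.

(** * The Efron-Stein inequality and i.i.d. samples *)

Section efron_stein2.
Context {R : realType} {d1 d2} {A : measurableType d1} {B : measurableType d2}.
Variables (mu : probability A R) (nu : probability B R).

Lemma adde_le_halve (x y : \bar R) : (x + x <= y + y -> x <= y)%E.
Proof.
case: x => [x||]; case: y => [y||] //=; rewrite ?leey ?leNye//.
by rewrite -!EFinD !lee_fin; lra.
Qed.

(** Two independent pairs span a square with vertices (a,b), (a',b), (a,b'), (a',b'). The squared
    increments of [f] along the two diagonals sum to at most those along the four sides. Each
    diagonal integrates to the left side, and each of the two pairs of opposite sides to twice one
    term of the right side, which gives the inequality doubled. *)
Lemma efron_stein2 (f : A * B -> R) : measurable_fun setT f ->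
  (\int[pprod (pprod mu nu) (pprod mu nu)]_z ((f z.1 - f z.2) ^+ 2)%:E <=
   \int[pprod nu (pprod mu mu)]_w ((f (w.2.1, w.1) - f (w.2.2, w.1)) ^+ 2)%:E +
   \int[pprod mu (pprod nu nu)]_w ((f (w.1, w.2.1) - f (w.1, w.2.2)) ^+ 2)%:E)%E.
Proof.
move=> mf.
pose Om := pprod (pprod mu nu) (pprod mu nu).
pose g (z : (A * B) * (A * B)) : \bar R := ((f z.1 - f z.2) ^+ 2)%:E.
have mg : measurable_fun setT g.
  apply/measurable_EFinP/measurable_funX/measurable_funB;
    exact: (measurableT_comp mf).
have g0 z : (0 <= g z)%E by rewrite lee_fin sqr_ge0.
pose ga (w : B * (A * A)) : \bar R := ((f (w.2.1, w.1) - f (w.2.2, w.1)) ^+ 2)%:E.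
pose gb (w : A * (B * B)) : \bar R := ((f (w.1, w.2.1) - f (w.1, w.2.2)) ^+ 2)%:E.
have mga : measurable_fun setT ga.
  apply/measurable_EFinP/measurable_funX/measurable_funB;
    by apply: (measurableT_comp mf); apply: measurable_fun_pair => //;
      exact: measurableT_comp.
have mgb : measurable_fun setT gb.
  apply/measurable_EFinP/measurable_funX/measurable_funB;
    by apply: (measurableT_comp mf); apply: measurable_fun_pair => //;
      exact: measurableT_comp.
have ga0 z : (0 <= ga z)%E by rewrite lee_fin sqr_ge0.
have gb0 z : (0 <= gb z)%E by rewrite lee_fin sqr_ge0.
have ex := measure_preserving_exchange mu nu mu nu.
have [mx ix] : measure_preserving Om Om
    (fun z => ((z.2.1, z.1.2), (z.1.1, z.2.2))).
  exact: measure_preserving_comp (measure_preserving_comp ex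
    (measure_preserving_prod (measure_preserving_swap mu mu)
      (measure_preserving_id (pprod nu nu))))
    (measure_preserving_exchange mu mu nu nu).
have [ma1 ia1] : measure_preserving Om (pprod nu (pprod mu mu))
    (fun z => (z.1.2, (z.1.1, z.2.1))).
  exact: measure_preserving_comp (measure_preserving_comp ex
    (measure_preserving_prod (measure_preserving_id (pprod mu mu))
      (measure_preserving_fst nu nu)))
    (measure_preserving_swap (pprod mu mu) nu).
have [ma2 ia2] : measure_preserving Om (pprod nu (pprod mu mu))
    (fun z => (z.2.2, (z.1.1, z.2.1))).
  exact: measure_preserving_comp (measure_preserving_comp ex
    (measure_preserving_prod (measure_preserving_id (pprod mu mu))
      (measure_preserving_snd nu nu)))
    (measure_preserving_swap (pprod mu mu) nu).
have [mb1 ib1] : measure_preserving Om (pprod mu (pprod nu nu))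
    (fun z => (z.1.1, (z.1.2, z.2.2))).
  exact: measure_preserving_comp ex
    (measure_preserving_prod (measure_preserving_fst mu mu)
      (measure_preserving_id (pprod nu nu))).
have [mb2 ib2] : measure_preserving Om (pprod mu (pprod nu nu))
    (fun z => (z.2.1, (z.1.2, z.2.2))).
  exact: measure_preserving_comp ex
    (measure_preserving_prod (measure_preserving_snd mu mu)
      (measure_preserving_id (pprod nu nu))).
have mc d (X : measurableType d) (h : X -> \bar R) phi :
    measurable_fun setT h -> measurable_fun setT phi ->
    measurable_fun [set: (A * B) * (A * B)] (fun z => h (phi z)).
  by move=> mh mphi; exact: measurableT_comp.
pose Ig := (\int[Om]_z g z)%E.
pose Ia := (\int[pprod nu (pprod mu mu)]_w ga w)%E.
pose Ib := (\int[pprod mu (pprod nu nu)]_w gb w)%E.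
rewrite -[leLHS]/Ig -[leRHS]/(Ia + Ib)%E; apply: adde_le_halve.
have -> : (Ig + Ig = \int[Om]_z (g z + g ((z.2.1, z.1.2), (z.1.1, z.2.2))))%E.
  by rewrite ge0_integralD//; [rewrite ix|exact: mc].
have -> : (Ia + Ib + (Ia + Ib) =
    \int[Om]_z (ga (z.1.2, (z.1.1, z.2.1)) + ga (z.2.2, (z.1.1, z.2.1)) +
    (gb (z.1.1, (z.1.2, z.2.2)) + gb (z.2.1, (z.1.2, z.2.2)))))%E.
  rewrite addeACA !ge0_integralD//; try by [exact: mc|
    move=> *; exact: adde_ge0|apply: emeasurable_funD; exact: mc].
  by rewrite (ia1 ga)// (ia2 ga)// (ib1 gb)// (ib2 gb).
apply: ge0_le_integral => //; try by [move=> *; rewrite ?adde_ge0|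
  apply: emeasurable_funD; exact: mc|
  apply: emeasurable_funD; apply: emeasurable_funD; exact: mc].
  by apply: emeasurable_funD => //; exact: mc.
move=> [[a b] [a' b']] _; rewrite /g /ga /gb /= -!EFinD lee_fin.
(* the difference of the two sides is the square of a second difference *)
have := sqr_ge0 (f (a, b) + f (a', b') - f (a', b) - f (a, b')).
by nra.
Qed.

End efron_stein2.

Section iid_theory.
Context {R : realType} {d} {T : measurableType d}.
Implicit Types P : probability T R.

Lemma measure_preserving_cons P n :
  measure_preserving (pprod P (iid P n)) (iid P n.+1) (@tuple_cons d T n).
Proof.
have mc := @measurable_tuple_cons d T n.
split=> // f mf f0.
have := ge0_integral_pushforward mc (pprod P (iid P n)) measurableT mf.
by rewrite preimage_setT => <- // x _; exact: f0.
Qed.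

Lemma integral_iid0 P (f : 0.-tuple T -> \bar R) :
  (\int[iid P 0]_t f t = f [tuple])%E.
Proof.
rewrite (_ : f = fun=> f [tuple]); first exact: integral_prob_cst.
by apply/funext => t; rewrite tuple0.
Qed.

Lemma measure_preserving_tnth P n (i : 'I_n) :
  measure_preserving (iid P n) P (fun t => tnth t i).
Proof.
elim: n i => [[]//|n IH] i.
apply: (measure_preserving_cancel _ (measure_preserving_cons P n)).
  exact: measurable_tnth.
case: (unliftP ord0 i) => [j|] ->.
  rewrite (_ : _ \o _ = (fun t => tnth t j) \o snd).
    exact: measure_preserving_comp (measure_preserving_snd _ _) (IH j).
  by apply/funext => z /=; rewrite tnthS.
rewrite (_ : _ \o _ = fst); first exact: measure_preserving_fst.
by apply/funext.
Qed.

Lemma measurable_tuple {d'} {A : measurableType d'} n (g : A -> n.-tuple T) :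
  (forall i, measurable_fun setT (fun a => tnth (g a) i)) ->
  measurable_fun setT g.
Proof. by move=> h; apply/measurable_fun_tnthP => i; exact: h. Qed.

Lemma measure_preserving_map P (phi : T -> T) n :
  measure_preserving P P phi ->
  measure_preserving (iid P n) (iid P n) (map_tuple phi).
Proof.
move=> Pphi.
have mmap m : measurable_fun [set: m.-tuple T] (map_tuple phi).
  apply: measurable_tuple => i; under eq_fun do rewrite tnth_map.
  by apply: measurableT_comp; [exact: Pphi.1|exact: measurable_tnth].
elim: n => [|n IH].
  split; first exact: mmap.
  by move=> f mf f0; rewrite !integral_iid0; congr f; exact: val_inj.
apply: (measure_preserving_cancel (mmap _) (measure_preserving_cons P n)).
rewrite (_ : _ \o _ = (@tuple_cons d T n) \o
    (fun z => (phi z.1, map_tuple phi z.2))); last first.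
  by apply/funext => z /=; exact: val_inj.
exact: measure_preserving_comp (measure_preserving_prod Pphi IH)
  (measure_preserving_cons P n).
Qed.

(** [tmix e x y] and [tmix e y x] are what two samples become when they exchange the coordinates at
    which [e] is true. *)
Definition tmix n (e : n.-tuple bool) (x y : n.-tuple T) : n.-tuple T :=
  [tuple if tnth e i then tnth y i else tnth x i | i < n].

Lemma tmix_cons n b (e : n.-tuple bool) x y (u v : n.-tuple T) :
  tmix [tuple of b :: e] [tuple of x :: u] [tuple of y :: v] =
  [tuple of (if b then y else x) :: tmix e u v].
Proof.
apply: eq_from_tnth => i; rewrite tnth_mktuple.
case: (unliftP ord0 i) => [j|] ->; first by rewrite !tnthS tnth_mktuple.
by rewrite !tnth0.
Qed.

Lemma measurable_tmix n (e : n.-tuple bool) :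
  measurable_fun setT
    (fun z : n.-tuple T * n.-tuple T => tmix e z.1 z.2).
Proof.
apply: measurable_tuple => i; under eq_fun do rewrite tnth_mktuple.
case: (tnth e i).
  exact: (measurableT_comp (@measurable_tnth _ T n i) measurable_snd).
exact: (measurableT_comp (@measurable_tnth _ T n i) measurable_fst).
Qed.

(** The pairs (x_i, y_i) are independent of each other and each is exchangeable, so swapping some of
    them leaves the joint law unchanged. *)
Lemma measure_preserving_tmix P n (e : n.-tuple bool) :
  measure_preserving (pprod (iid P n) (iid P n)) (pprod (iid P n) (iid P n))
    (fun z => (tmix e z.1 z.2, tmix e z.2 z.1)).
Proof.
have mm m (s : m.-tuple bool) : measurable_fun setT
    (fun z : m.-tuple T * m.-tuple T => (tmix s z.1 z.2, tmix s z.2 z.1)).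
  apply: measurable_fun_pair; first exact: measurable_tmix.
  have sw : measurable_fun setT
    (fun z : m.-tuple T * m.-tuple T => (z.2, z.1)) by exact: measurable_fun_pair.
  exact: (measurableT_comp (@measurable_tmix _ s) sw).
elim: n e => [|n IH] e.
  rewrite (_ : (fun _ => _) = idfun); first exact: measure_preserving_id.
  by apply/funext => -[x y]; rewrite [x]tuple0 [y]tuple0/= !(tuple0 (tmix _ _ _)).
case/tupleP: e => b e.
have hc := measure_preserving_prod (measure_preserving_cons P n)
  (measure_preserving_cons P n).
apply: (measure_preserving_cancel (mm _ _) hc).
have hb : measure_preserving (pprod P P) (pprod P P)
    (fun z => (if b then z.2 else z.1, if b then z.1 else z.2)).
  case: b; first exact: measure_preserving_swap.
  rewrite (_ : (fun _ => _) = idfun); first exact: measure_preserving_id.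
  by apply/funext => -[].
have ex := measure_preserving_exchange P (iid P n) P (iid P n).
have := measure_preserving_comp (measure_preserving_comp
  (measure_preserving_comp ex (measure_preserving_prod hb (IH e)))
  (measure_preserving_exchange P P (iid P n) (iid P n))) hc.
congr measure_preserving; apply/funext => -[[x u] [y v]] /=.
by rewrite /tuple_cons/= !tmix_cons.
Qed.

(* Independent copies replace variances, so that only nonnegative functions are
   integrated. *)
Lemma efron_stein P n (f : n.-tuple T -> R) (q : 'I_n -> T * T -> R) :
  measurable_fun setT f -> (forall i, measurable_fun setT (q i)) ->
  (forall i t t', (forall j, j != i -> tnth t j = tnth t' j) ->
    (f t - f t') ^+ 2 <= q i (tnth t i, tnth t' i)) ->
  (\int[pprod (iid P n) (iid P n)]_z ((f z.1 - f z.2) ^+ 2)%:E <=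
   \sum_(i < n) \int[pprod P P]_w (q i w)%:E)%E.
Proof.
elim: n f q => [|n IH] f q mf mq fq.
  rewrite big_ord0 integral0_eq// => -[x y] _ /=.
  by rewrite [x]tuple0 [y]tuple0 subrr expr0n.
pose g := f \o @tuple_cons d T n.
have mg : measurable_fun setT g.
  exact: measurableT_comp mf (@measurable_tuple_cons d T n).
have q0 i w : 0 <= q i w.
  case: w => u v.
  (* Any pair (u, v) is realized at coordinate i by a constant tuple and its modification at i, so
     the bound on squared increments forces [q i] to be nonnegative. *)
  pose t := [tuple of nseq n.+1 u].
  pose t' : n.+1.-tuple T := [tuple if j == i then v else u | j < n.+1].
  have := fq i t t'; rewrite tnth_nseq tnth_mktuple eqxx.
  move=> h; apply: le_trans (h _); first exact: sqr_ge0.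
  by move=> j ji; rewrite tnth_nseq tnth_mktuple (negbTE ji).
have hc := measure_preserving_prod (measure_preserving_cons P n)
  (measure_preserving_cons P n).
rewrite -(hc.2 (fun z => ((f z.1 - f z.2) ^+ 2)%:E)); last 2 first.
- apply/measurable_EFinP/measurable_funX/measurable_funB;
    exact: (measurableT_comp mf).
- by move=> z; rewrite lee_fin sqr_ge0.
(* The first coordinate is one block and the rest the other: the former is bounded by [q ord0], the
   latter by the induction hypothesis for each fixed first coordinate. *)
apply: le_trans (efron_stein2 P (iid P n) mg) _.
rewrite big_ord_recl; apply: leeD.
  rewrite -((measure_preserving_snd (iid P n) (pprod P P)).2
    (fun w => (q ord0 w)%:E)); last 2 first.
  - exact/measurable_EFinP.
  - by move=> w; rewrite lee_fin.
  apply: ge0_le_integral => //.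
  - by move=> w _; rewrite lee_fin sqr_ge0.
  - apply/measurable_EFinP/measurable_funX/measurable_funB;
      by apply: (measurableT_comp mg); apply: measurable_fun_pair => //;
        exact: measurableT_comp.
  - by apply/measurable_EFinP; exact: measurableT_comp.
  move=> [t [u v]] _; rewrite lee_fin /g/= /tuple_cons/=.
  apply: le_trans (fq ord0 _ _ _) _; last by rewrite !tnth0.
  by move=> j; case: (unliftP ord0 j) => [k|] ->; rewrite ?eqxx// !tnthS.
have mg2 : measurable_fun setT (fun w : T * (n.-tuple T * n.-tuple T) =>
    ((g (w.1, w.2.1) - g (w.1, w.2.2)) ^+ 2)%:E).
  apply/measurable_EFinP/measurable_funX/measurable_funB;
    by apply: (measurableT_comp mg); apply: measurable_fun_pair => //;
      exact: measurableT_comp.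
rewrite (fubini_tonelli1 (m1 := P) (m2 := pprod (iid P n) (iid P n)) _ mg2);
  last by move=> w; rewrite lee_fin sqr_ge0.
rewrite -[leRHS](integral_prob_cst P).
apply: ge0_le_integral => //.
- by move=> u _; apply: integral_ge0 => w _; rewrite lee_fin sqr_ge0.
- apply: (measurable_fun_fubini_tonelli_F _ mg2).
  by move=> w; rewrite lee_fin sqr_ge0.
move=> u _; rewrite /fubini_F/=.
apply: (IH (fun t => g (u, t)) (fun i => q (lift ord0 i))) => //.
  exact: measurableT_comp mg (measurable_pair1 _).
move=> i t t' tt'; rewrite /g/= /tuple_cons/=.
have := fq (lift ord0 i) [tuple of u :: t] [tuple of u :: t'].
rewrite !tnthS; apply => j.
case: (unliftP ord0 j) => [k|] ->; last by rewrite !tnth0.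
by rewrite (inj_eq (@lift_inj _ _)) !tnthS; exact: tt'.
Qed.

End iid_theory.

(** * Gaussian versus Rademacher averages *)

Section sign_average_integral.
Context {R : realType} {d} {A : measurableType d}.

Lemma measurable_savg n (G : n.-tuple bool -> A -> R) :
  (forall e, measurable_fun setT (G e)) ->
  measurable_fun setT (fun a => savg (fun e => G e a)).
Proof.
elim: n G => [|n IH] G mG /=; first exact: mG.
apply: measurable_funM => //; apply: measurable_funD;
  [exact: (IH (fun e => G [tuple of false :: e]))|
   exact: (IH (fun e => G [tuple of true :: e]))].
Qed.

Lemma savg_ge0 n (F : n.-tuple bool -> R) : (forall e, 0 <= F e) -> 0 <= savg F.
Proof. by move=> F0; rewrite -(savg_cst n 0); exact: le_savg. Qed.

Lemma ge0_integral_half (mu : {measure set A -> \bar R}) (F G : A -> R) :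
  measurable_fun setT F -> measurable_fun setT G ->
  (forall a, 0 <= F a) -> (forall a, 0 <= G a) ->
  (\int[mu]_a ((F a + G a) / 2)%:E =
   (2^-1)%:E * (\int[mu]_a (F a)%:E + \int[mu]_a (G a)%:E))%E.
Proof.
move=> mF mG F0 G0.
have mFe : measurable_fun setT (fun a => (F a)%:E) by exact/measurable_EFinP.
have mGe : measurable_fun setT (fun a => (G a)%:E) by exact/measurable_EFinP.
under eq_integral do rewrite mulrC EFinM EFinD.
rewrite ge0_integralZl//.
- by rewrite ge0_integralD// => a _; rewrite lee_fin.
- exact: emeasurable_funD.
- by move=> a _; rewrite -EFinD lee_fin addr_ge0.
Qed.

Lemma savg_le_integral (mu : {measure set A -> \bar R}) n
    (G : n.-tuple bool -> A -> R) (c : n.-tuple bool -> R) :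
  (forall e, measurable_fun setT (G e)) -> (forall e a, 0 <= G e a) ->
  (forall e, (c e)%:E <= \int[mu]_a (G e a)%:E)%E ->
  ((savg c)%:E <= \int[mu]_a (savg (fun e => G e a))%:E)%E.
Proof.
elim: n G c => [|n IH] G c mG G0 cG /=; first exact: cG.
rewrite ge0_integral_half.
- rewrite mulrC EFinM EFinD lee_pmul2l//.
  by apply: leeD; apply: IH.
- exact: (measurable_savg (fun e => mG [tuple of false :: e])).
- exact: (measurable_savg (fun e => mG [tuple of true :: e])).
- by move=> a; exact: savg_ge0.
- by move=> a; exact: savg_ge0.
Qed.

Lemma integral_savg_le (mu : {measure set A -> \bar R}) n
    (G : n.-tuple bool -> A -> R) (c : \bar R) :
  (0 <= c)%E ->
  (forall e, measurable_fun setT (G e)) -> (forall e a, 0 <= G e a) ->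
  (forall e, \int[mu]_a (G e a)%:E <= c)%E ->
  (\int[mu]_a (savg (fun e => G e a))%:E <= c)%E.
Proof.
move=> c0; elim: n G => [|n IH] G mG G0 cG /=; first exact: cG.
rewrite ge0_integral_half.
- have h : (2^-1%:E * (c + c) = c)%E.
    case: c c0 {IH cG} => [c||]//= _.
      by rewrite -EFinD -EFinM; congr EFin; field.
    by rewrite addye// gt0_muley// lte_fin invr_gt0.
  rewrite -[leRHS]h lee_pmul2l//.
  by apply: leeD; apply: IH.
- exact: (measurable_savg (fun e => mG [tuple of false :: e])).
- exact: (measurable_savg (fun e => mG [tuple of true :: e])).
- by move=> a; exact: savg_ge0.
- by move=> a; exact: savg_ge0.
Qed.

(** Monotonicity with a signed lower function, as required by the affine minorants in the absolute
    value used for the Gaussian comparison: replacing [f] by its positive part only increases its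
    integral. *)
Lemma le_integral_ge0 (mu : {measure set A -> \bar R}) (f g : A -> \bar R) :
  measurable_fun setT f -> measurable_fun setT g -> (forall a, 0 <= g a)%E ->
  (forall a, f a <= g a)%E -> (\int[mu]_a f a <= \int[mu]_a g a)%E.
Proof.
move=> mf mg g0 fg; rewrite integralE.
apply: (@le_trans _ _ (\int[mu]_a f^\+ a)%E).
  rewrite -[leRHS]sube0 leeB//; apply: integral_ge0 => a _.
  exact: funeneg_ge0.
apply: ge0_le_integral => //.
  exact: measurable_funepos.
by move=> a _; rewrite funeposE ge_max fg/= g0.
Qed.

End sign_average_integral.

Section gaussian_process.
Context {R : realType} {J : Type}.
Variable A : set J.
Notation gauss := (@gauss R).
Notation gauss_abs := (@gauss_abs R).

Lemma integral_gauss_affine (p q : R) :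
  (\int[gauss]_u (p + q * `|u|)%:E = (p + q * gauss_abs)%:E)%E.
Proof.
have mabs : measurable_fun [set: measurableTypeR R] (fun x => (`|x|)%:E).
  by apply/measurable_EFinP; exact: normr_measurable.
have ia : gauss.-integrable setT (fun u : measurableTypeR R => (`|u|)%:E).
  apply/integrableP; split => //.
  by under eq_integral do rewrite /= normr_id; rewrite gauss_absE ltry.
under eq_integral do rewrite EFinD EFinM.
rewrite integralD//; last 2 first.
- exact: (finite_measure_integrable_cst gauss p).
- exact: integrableZl.
by rewrite integralZl// gauss_absE (integral_prob_cst gauss).
Qed.

(** Jensen's inequality for one Gaussian coordinate. By symmetry of the law, [phi] may be replaced
    by its even part, a convex function of [|u|], and the mean of [|u|] is [gauss_abs]. Since [phi]
    is a supremum of affine functions, explicit minorants take the place of a general convexity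
    theorem. *)
Lemma gauss_isup_ge (al be : J -> R) M :
  A !=set0 -> (forall j, A j -> `|al j| <= M) ->
  (forall j, A j -> `|be j| <= M) ->
  let phi := fun u => sup [set al j + u * be j | j in A] in
  measurable_fun [set: measurableTypeR R] phi -> (forall u, 0 <= phi u) ->
  (((phi gauss_abs + phi (- gauss_abs)) / 2)%:E <= \int[gauss]_u (phi u)%:E)%E.
Proof.
move=> [j0 Aj0] alM beM phi mphi phi0.
have M0 : 0 <= M by exact: le_trans (alM _ Aj0).
have bnd u j : A j -> al j + u * be j <= M + `|u| * M.
  move=> Aj; apply: lerD; first by apply: le_trans (ler_norm _) (alM _ _).
  apply: le_trans (ler_norm _) _; rewrite normrM ler_wpM2l//; exact: beM.
have ub u j : A j -> al j + u * be j <= phi u.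
  by move=> Aj; exact: (isup_ub (bnd u) Aj).
have mN : measurable_fun [set: measurableTypeR R] (fun u => phi (- u)).
  have mneg : measurable_fun [set: measurableTypeR R]
    (-%R : _ -> measurableTypeR R) by exact: oppr_measurable.
  exact: (measurableT_comp mphi mneg).
have sym : (\int[gauss]_u (phi u)%:E =
    \int[gauss]_u ((phi u + phi (- u)) / 2)%:E)%E.
  rewrite ge0_integral_half//.
  have mphiE : measurable_fun [set: measurableTypeR R] (fun u => (phi u)%:E).
    exact/measurable_EFinP.
  have phiE0 u : (0 <= (phi u)%:E)%E by rewrite lee_fin.
  rewrite (measure_preserving_gaussN.2 _ mphiE phiE0).
  set I := (\int[_]_u _)%E; case: I => [r||]//=.
  - by rewrite -EFinD -EFinM; congr EFin; field.
  - by rewrite gt0_muley// lte_fin invr_gt0.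
  - by rewrite gt0_muleNy// lte_fin invr_gt0.
(* Bounding [phi] at [|u|] by index j and at [-|u|] by index k gives a minorant of the even part
   that is affine in [|u|], with an explicit integral. The suprema over j and over k are taken
   separately at the end. *)
have pw j k : A j -> A k ->
    (((al j + gauss_abs * be j + (al k + (- gauss_abs) * be k)) / 2)%:E <=
    \int[gauss]_u (phi u)%:E)%E.
  move=> Aj Ak.
  have := integral_gauss_affine ((al j + al k) / 2) ((be j - be k) / 2).
  rewrite (_ : _ + _ * gauss_abs = (al j + gauss_abs * be j +
    (al k + (- gauss_abs) * be k)) / 2); last by field.
  move=> <-; rewrite sym; apply: le_integral_ge0.
  - apply/measurable_EFinP/measurable_funD => //; apply: measurable_funM => //.
  - apply/measurable_EFinP/measurable_funM => //; exact: measurable_funD.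
  - by move=> u; rewrite lee_fin mulr_ge0 ?invr_ge0// addr_ge0.
  move=> u; rewrite lee_fin.
  have h1 := ub u _ Aj; have h2 := ub (- u) _ Ak.
  have h3 := ub (- u) _ Aj; have h4 := ub u _ Ak.
  by case: (ger0P u) => hu; nra.
case E : (\int[gauss]_u (phi u)%:E)%E => [r||]; last 2 first.
- by rewrite leey.
- have : (0 <= \int[gauss]_u (phi u)%:E)%E.
    by apply: integral_ge0 => u _; rewrite lee_fin.
  by rewrite E.
rewrite lee_fin ler_pdivrMr// -lerBrDr.
apply: (isup_le Aj0) => j Aj; rewrite lerBrDr addrC -lerBrDr.
apply: (isup_le Aj0) => k Ak.
have := pw _ _ Aj Ak; rewrite E lee_fin; lra.
Qed.

(** Gaussian weights dominate signs scaled by [gauss_abs], by [gauss_isup_ge] one coordinate at a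
    time. The index [j0] with vanishing coefficients keeps all the suprema nonnegative, and the
    offset [a] absorbs the coordinate already conditioned on. *)
Lemma gauss_process_ge n (a : J -> R) (v : J -> 'I_n -> R) j0 :
  A j0 -> a j0 = 0 -> (forall i, v j0 i = 0) ->
  (exists M, forall k, A k -> `|a k| <= M) ->
  (exists M, forall k i, A k -> `|v k i| <= M) ->
  measurable_fun [set: n.-tuple (measurableTypeR R)]
    (fun xi => sup [set a k + \sum_(i < n) tnth xi i * v k i | k in A]) ->
  ((savg (fun e => sup [set a k +
      \sum_(i < n) sgb (tnth e i) * (gauss_abs * v k i) | k in A]))%:E <=
   \int[iid gauss n]_xi
     (sup [set a k + \sum_(i < n) tnth xi i * v k i | k in A])%:E)%E.
Proof.
move=> Aj0; elim: n a v => [|n IH] a v a0 v0 [Ma aM] [Mv vM] mPhi.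
  rewrite (integral_iid0 gauss
    (fun xi => (sup [set a k + \sum_(i < 0) tnth xi i * v k i | k in A])%:E)).
  rewrite /= lee_fin le_eqVlt; apply/orP; left; apply/eqP; congr sup.
  by apply: eq_imagel => k _; rewrite !big_ord0.
have Ma0 : 0 <= Ma by exact: le_trans (aM _ Aj0).
have Mv0 : 0 <= Mv by exact: le_trans (vM _ ord0 Aj0).
set Phi := (fun xi => _) in mPhi *.
have ubs (xi : n.+1.-tuple R) k : A k -> a k + \sum_(i < n.+1) tnth xi i * v k i <=
    Ma + \sum_(i < n.+1) `|tnth xi i| * Mv.
  move=> Ak; apply: lerD; first by apply: le_trans (ler_norm _) (aM _ _).
  apply: ler_sum => i _; apply: le_trans (ler_norm _) _.
  by rewrite normrM ler_wpM2l//; exact: vM.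
have Phi0 xi : 0 <= Phi xi.
  apply: le_trans (isup_ub (ubs xi) Aj0).
  by rewrite a0 add0r sumr_ge0// => i _; rewrite v0 mulr0.
pose v' k i := v k (lift ord0 i).
pose Psi u (e : n.-tuple bool) := sup [set a k + u * v k ord0 +
  \sum_(i < n) sgb (tnth e i) * (gauss_abs * v' k i) | k in A].
(* The mixed process is [Phi] at a particular point, so its measurability and sign come from those
   of [Phi]. *)
have PsiE u e : Psi u e = Phi [tuple of u :: map_tuple (fun b => sgb b * gauss_abs) e].
  rewrite /Psi /Phi; congr sup; apply: eq_imagel => k _.
  rewrite big_ord_recl tnth0 addrA; congr (_ + _); apply: eq_bigr => i _.
  by rewrite tnthS tnth_map mulrA.
have mcons (t : n.-tuple (measurableTypeR R)) : measurable_fun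
    [set: measurableTypeR R] (fun u => [tuple of u :: t] : n.+1.-tuple (measurableTypeR R)).
  exact: measurableT_comp (@measurable_tuple_cons _ _ n) (measurable_pair2 _).
have mPsi e : measurable_fun [set: measurableTypeR R] (Psi ^~ e).
  under eq_fun do rewrite PsiE.
  exact: measurableT_comp mPhi (mcons _).
have mce : measurable_fun [set: measurableTypeR R * n.-tuple (measurableTypeR R)]
    (fun z => (Phi (tuple_cons z))%:E).
  apply/measurable_EFinP.
  exact: measurableT_comp mPhi (@measurable_tuple_cons _ _ n).
rewrite -((measure_preserving_cons gauss n).2 (fun xi => (Phi xi)%:E)); last 2 first.
- exact/measurable_EFinP.
- by move=> xi; rewrite lee_fin.
rewrite (fubini_tonelli1 (m1 := gauss) (m2 := iid gauss n) _ mce); last first.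
  by move=> z; rewrite lee_fin.
(* Intermediate stage: the first weight is still Gaussian and the others are already signs. One
   comparison is the induction hypothesis for fixed [u], the other is the one-coordinate inequality
   for fixed signs. *)
apply: (@le_trans _ _ (\int[gauss]_u (savg (Psi u))%:E)%E); last first.
  apply: ge0_le_integral => //.
  - by move=> u _; rewrite lee_fin savg_ge0// => e; rewrite PsiE.
  - by apply/measurable_EFinP; exact: measurable_savg.
  - apply: (measurable_fun_fubini_tonelli_F _ mce).
    by move=> z; rewrite lee_fin.
  move=> u _; rewrite /fubini_F.
  have PhiE (t : n.-tuple R) : Phi (tuple_cons (u, t)) =
      sup [set (a k + u * v k ord0) + \sum_(i < n) tnth t i * v' k i | k in A].
    rewrite /Phi; congr sup; apply: eq_imagel => k _.
    rewrite big_ord_recl tnth0 addrA; congr (_ + _); apply: eq_bigr => i _.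
    by rewrite tnthS.
  under eq_integral do rewrite PhiE.
  apply: (IH (fun k => a k + u * v k ord0) v').
  - by rewrite a0 v0 mulr0 addr0.
  - by move=> i; rewrite /v' v0.
  - exists (Ma + `|u| * Mv) => k Ak; apply: le_trans (ler_normD _ _) _.
    by apply: lerD; [exact: aM|rewrite normrM ler_wpM2l//; exact: vM].
  - by exists Mv => k i Ak; exact: vM.
  - rewrite (_ : (fun _ => _) = (fun t => Phi (tuple_cons (u, t)))).
      apply: measurableT_comp mPhi _.
      exact: measurableT_comp (@measurable_tuple_cons _ _ n) (measurable_pair1 _).
    by apply/funext => t; rewrite PhiE.
have Psi0 e u : 0 <= Psi u e by rewrite PsiE.
have hc e : (((Psi gauss_abs e + Psi (- gauss_abs) e) / 2)%:E <=
    \int[gauss]_u (Psi u e)%:E)%E.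
  pose al k := a k + \sum_(i < n) sgb (tnth e i) * (gauss_abs * v' k i).
  have PE u : Psi u e = sup [set al k + u * v k ord0 | k in A].
    by rewrite /Psi; congr sup; apply: eq_imagel => k _; rewrite /al addrAC.
  rewrite !PE; under eq_integral do rewrite PE.
  have g0 : 0 <= gauss_abs := ltW gauss_abs_gt0.
  apply: (@gauss_isup_ge al (v ^~ ord0) (Ma + n%:R * (gauss_abs * Mv) + Mv)).
  - by exists j0.
  - move=> k Ak; rewrite -[leLHS]addr0 lerD//; apply: le_trans (ler_normD _ _) _.
    rewrite lerD//; first exact: aM.
    apply: le_trans (ler_norm_sum _ _ _) _.
    rewrite -[n in n%:R]card_ord mulr_natl -sumr_const ler_sum// => i _.
    rewrite normrM /sgb normr_sign mul1r normrM ger0_norm// ler_wpM2l//.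
    exact: vM.
  - move=> k Ak; apply: le_trans (vM _ _ Ak) _.
    by rewrite lerDr addr_ge0// mulr_ge0// mulr_ge0.
  - by rewrite (_ : (fun _ => _) = Psi ^~ e)//; apply/funext => u; rewrite PE.
  - by move=> u; rewrite -PE PsiE.
apply: le_trans (savg_le_integral mPsi Psi0 hc).
rewrite lee_fin; under [leRHS]eq_savg do rewrite mulrC.
rewrite savgZ savgD /= [leRHS]mulrC ler_pM2r ?invr_gt0// lerD//.
  apply: le_savg => e; rewrite /Psi.
  under eq_imagel do rewrite sum_sgb_cons sgbF mul1r addrA.
  exact: lexx.
apply: le_savg => e; rewrite /Psi.
under eq_imagel do rewrite sum_sgb_cons sgbT mulN1r addrA -mulNr.
exact: lexx.
Qed.

End gaussian_process.

(** * The centered Gaussian process of a class *)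

Section L2norm.
Context {R : realType} {d} {T : measurableType d} (P : probability T R).

Lemma L2normE (f : T -> R) : L2norm P f = sqrte (\int[P]_x (f x ^+ 2)%:E).
Proof.
rewrite /L2norm unlock poweR12_sqrt; last first.
  by apply: integral_ge0 => x _; exact: poweR_ge0.
congr sqrte; apply: eq_integral => x _ /=.
by rewrite powR_mulrn// real_normK// num_real.
Qed.

Lemma L2norm_le (f : T -> R) (r : R) : 0 <= r ->
  (L2norm P f <= r%:E)%E = (\int[P]_x (f x ^+ 2)%:E <= (r ^+ 2)%:E)%E.
Proof.
move=> r0; rewrite L2normE.
have -> : r%:E = sqrte (r ^+ 2)%:E by rewrite /= sqrtr_sqr ger0_norm.
by rewrite lee_sqrt// lee_fin sqr_ge0.
Qed.

Lemma le_L2norm (f : T -> R) (r : R) : 0 <= r ->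
  (r%:E <= L2norm P f)%E = ((r ^+ 2)%:E <= \int[P]_x (f x ^+ 2)%:E)%E.
Proof.
move=> r0; rewrite L2normE.
have -> : r%:E = sqrte (r ^+ 2)%:E by rewrite /= sqrtr_sqr ger0_norm.
by rewrite lee_sqrt// integral_ge0// => x _; rewrite lee_fin sqr_ge0.
Qed.

Lemma integral_iid_sum n (g : 'I_n -> T -> R) :
  (forall i, measurable_fun setT (g i)) -> (forall i x, 0 <= g i x) ->
  (\int[iid P n]_t (\sum_(i < n) g i (tnth t i))%:E =
   \sum_(i < n) \int[P]_x (g i x)%:E)%E.
Proof.
move=> mg g0; under eq_integral do rewrite -sumEFin.
rewrite ge0_integral_sum//.
- apply: eq_bigr => i _.
  apply: ((measure_preserving_tnth P i).2 (fun x => (g i x)%:E)).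
    exact/measurable_EFinP.
  by move=> x; rewrite lee_fin.
- move=> i; apply/measurable_EFinP.
  exact: (measurableT_comp (mg i) (@measurable_tnth _ T n i)).
- by move=> i x _; rewrite lee_fin.
Qed.

End L2norm.

Section centered_process.
Context {R : realType} {d} {T : measurableType d}.
Implicit Types (G : set (T -> R)) (f g : T -> R).

Definition lin n f (z : n.-tuple T * n.-tuple (measurableTypeR R)) : R :=
  n%:R^-1 * \sum_(i < n) tnth z.2 i * f (tnth z.1 i).

(** The supremum of the process centered at [f]. For [f] in a bounded class it is nonnegative, and
    centering leaves the expectation unchanged because [lin f] has mean zero. *)
Definition cproc n G f (z : n.-tuple T * n.-tuple (measurableTypeR R)) : R :=
  gaussian_sup G z - lin f z.

Definition bounded_class G := forall f x, G f -> -1 <= f x <= 1.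

Lemma bounded_class_norm G f x : bounded_class G -> G f -> `|f x| <= 1.
Proof. by move=> Gb Gf; rewrite ler_norml; exact: Gb. Qed.

Lemma bounded_class_dist G f g x : bounded_class G -> G f -> G g ->
  `|f x - g x| <= 2.
Proof.
move=> Gb Gf Gg; have /andP[a b] := Gb _ x Gf; have /andP[a' b'] := Gb _ x Gg.
by rewrite ler_norml; apply/andP; split; lra.
Qed.

Lemma lin_dist n f g z :
  lin f z - lin g z =
  n%:R^-1 * \sum_(i < n) tnth z.2 i * (f (tnth z.1 i) - g (tnth z.1 i)).
Proof.
by rewrite /lin -mulrBr -sumrB; congr (_ * _); apply: eq_bigr => i _; rewrite mulrBr.
Qed.

Lemma lin_dist_le n G f g (z : n.-tuple T * n.-tuple (measurableTypeR R)) :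
  bounded_class G -> G f -> G g ->
  `|lin f z - lin g z| <= n%:R^-1 * \sum_(i < n) 2 * `|tnth z.2 i|.
Proof.
move=> Gb Gf Gg; rewrite lin_dist normrM ger0_norm ?invr_ge0// ler_wpM2l ?invr_ge0//.
apply: le_trans (ler_norm_sum _ _ _) _; apply: ler_sum => i _.
rewrite normrM mulrC ler_wpM2r//; exact: bounded_class_dist Gb _ _.
Qed.

Lemma lin_le n G f (z : n.-tuple T * n.-tuple (measurableTypeR R)) :
  bounded_class G -> G f -> lin f z <= n%:R^-1 * \sum_(i < n) `|tnth z.2 i|.
Proof.
move=> Gb Gf; rewrite /lin ler_wpM2l ?invr_ge0//; apply: ler_sum => i _.
apply: le_trans (ler_norm _) _; rewrite normrM -[leRHS]mulr1 ler_wpM2l//.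
exact: bounded_class_norm Gb _.
Qed.

Lemma cproc_ub n G f g (z : n.-tuple T * n.-tuple (measurableTypeR R)) :
  bounded_class G -> G g -> lin g z - lin f z <= cproc G f z.
Proof.
move=> Gb Gg; rewrite /cproc lerD2r /gaussian_sup.
by apply: (isup_ub _ Gg) => k Gk; exact: lin_le Gb Gk.
Qed.

Lemma cproc_le n G f g (z : n.-tuple T * n.-tuple (measurableTypeR R)) M :
  G g -> (forall k, G k -> lin k z - lin f z <= M) -> cproc G f z <= M.
Proof.
move=> Gg kM; rewrite /cproc lerBlDr /gaussian_sup.
by apply: (isup_le Gg) => k Gk; rewrite -lerBlDr; exact: kM.
Qed.

Lemma cproc_ge0 n G f (z : n.-tuple T * n.-tuple (measurableTypeR R)) :
  bounded_class G -> G f -> 0 <= cproc G f z.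
Proof. by move=> Gb Gf; rewrite -(subrr (lin f z)); exact: cproc_ub. Qed.

Lemma cproc_leS n G H f (z : n.-tuple T * n.-tuple (measurableTypeR R)) :
  bounded_class H -> G `<=` H -> G f -> cproc G f z <= cproc H f z.
Proof.
by move=> Hb GH Gf; apply: (cproc_le Gf) => k Gk; apply: cproc_ub => //; exact: GH.
Qed.

Lemma cproc_norm_le n G f (z : n.-tuple T * n.-tuple (measurableTypeR R)) :
  bounded_class G -> G f ->
  cproc G f z <= n%:R^-1 * \sum_(i < n) 2 * `|tnth z.2 i|.
Proof.
move=> Gb Gf; apply: (cproc_le Gf) => k Gk; apply: le_trans (ler_norm _) _.
exact: lin_dist_le Gb Gk Gf.
Qed.

Lemma cproc_dist n G f (z z' : n.-tuple T * n.-tuple (measurableTypeR R)) M :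
  bounded_class G -> G f ->
  (forall g, G g -> `|(lin g z - lin f z) - (lin g z' - lin f z')| <= M) ->
  `|cproc G f z - cproc G f z'| <= M.
Proof.
move=> Gb Gf gM; rewrite ler_distl; apply/andP; split.
  rewrite lerBlDr; apply: (cproc_le Gf) => g Gg.
  have := gM _ Gg; rewrite ler_distl => /andP[+ _].
  by have := @cproc_ub n G f g z Gb Gg; lra.
apply: (cproc_le Gf) => g Gg.
have := gM _ Gg; rewrite ler_distl => /andP[_ +].
by have := @cproc_ub n G f g z' Gb Gg; lra.
Qed.

Lemma measurable_lin n f : measurable_fun setT f ->
  measurable_fun setT (@lin n f).
Proof.
move=> mf; apply: measurable_funM => //; apply: measurable_sum => i.
apply: measurable_funM.
  exact: (measurableT_comp (@measurable_tnth _ (measurableTypeR R) n i) measurable_snd).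
apply: measurableT_comp mf _.
exact: (measurableT_comp (@measurable_tnth _ T n i) measurable_fst).
Qed.

Lemma measurable_cproc n G f : measurable_fun setT f ->
  measurable_fun setT (@gaussian_sup _ T R G n) ->
  measurable_fun setT (@cproc n G f).
Proof. by move=> mf mG; apply: measurable_funB => //; exact: measurable_lin. Qed.

Lemma cprocE n G f (x : n.-tuple T) (xi : n.-tuple (measurableTypeR R)) :
  bounded_class G -> G f ->
  cproc G f (x, xi) = sup [set (0 : R) + \sum_(i < n) tnth xi i *
    (n%:R^-1 * (g (tnth x i) - f (tnth x i))) | g in G].
Proof.
move=> Gb Gf.
have E g : 0 + \sum_(i < n) tnth xi i *
    (n%:R^-1 * (g (tnth x i) - f (tnth x i))) = lin g (x, xi) - lin f (x, xi).
  rewrite add0r lin_dist mulr_sumr; apply: eq_bigr => i _ /=.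
  by rewrite mulrCA.
under eq_imagel do rewrite E.
apply/eqP; rewrite eq_le; apply/andP; split.
  apply: (cproc_le Gf) => k Gk.
  by apply: (isup_ub (M := cproc G f (x, xi)) _ Gk) => h Gh; exact: cproc_ub.
by apply: (isup_le Gf) => k Gk; exact: cproc_ub.
Qed.

End centered_process.

Section averages.
Context {R : realType} {d} {T : measurableType d} (P : probability T R) (n : nat).
Notation gauss := (@gauss R).
Notation SL := (pprod (iid P n) (iid gauss n)).
Implicit Types (G : set (T -> R)) (f g : T -> R).

(** Flipping all noise signs preserves the law; for bounded [f] this forces the mean of [lin f] to
    be zero. *)
Lemma integral_lin_neg f : measurable_fun setT f ->
  (\int[SL]_z (lin f z)%:E = \int[SL]_z (- lin f z)%:E)%E.
Proof.
move=> mf.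
have mp := measure_preserving_prod (measure_preserving_id (iid P n))
  (measure_preserving_map n (@measure_preserving_gaussN R)).
rewrite -(measure_preserving_integral (f := fun z => (lin f z)%:E) mp); last first.
  by apply/measurable_EFinP; exact: measurable_lin.
apply: eq_integral => z _; congr EFin.
rewrite /lin/= -mulrN -sumrN; congr (_ * _); apply: eq_bigr => i _.
by rewrite tnth_map mulNr.
Qed.

Lemma integral_noise_sum (c : R) : 0 <= c ->
  (\int[SL]_z (n%:R^-1 * \sum_(i < n) c * `|tnth z.2 i|)%:E <= (c * gauss_abs)%:E)%E.
Proof.
move=> c0.
have mabs : measurable_fun [set: measurableTypeR R] (fun x => c * `|x|).
  by apply: measurable_funM => //; exact: normr_measurable.
have mS : measurable_fun [set: n.-tuple (measurableTypeR R)]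
    (fun t => (\sum_(i < n) c * `|tnth t i|)%:E).
  apply/measurable_EFinP; apply: measurable_sum => i.
  exact: (measurableT_comp mabs (@measurable_tnth _ (measurableTypeR R) n i)).
have g0 := @gauss_abs_gt0 R.
under eq_integral do rewrite EFinM.
rewrite ge0_integralZl//; last 2 first.
- exact: (measurableT_comp mS measurable_snd).
- by move=> z _; rewrite lee_fin sumr_ge0// => i _; rewrite mulr_ge0.
rewrite ((measure_preserving_snd (iid P n) (iid gauss n)).2 _ mS); last first.
  by move=> t; rewrite lee_fin sumr_ge0// => i _; rewrite mulr_ge0.
rewrite (integral_iid_sum gauss (fun=> mabs)); last by move=> i x; rewrite mulr_ge0.
have -> : (\int[gauss]_x (c * `|x|)%:E = (c * gauss_abs)%:E)%E.
  under eq_integral do rewrite EFinM.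
  rewrite ge0_integralZl//; first by rewrite gauss_absE.
  by apply/measurable_EFinP; exact: normr_measurable.
rewrite sumEFin sumr_const card_ord -EFinM lee_fin -(mulr_natl (c * gauss_abs)) [leLHS]mulrA.
have [->|n0] := posnP n; first by rewrite mulr0n mulr0 mul0r mulr_ge0// ltW.
by rewrite mulVf ?mul1r// pnatr_eq0 -lt0n.
Qed.

(** Both [lin f] and [cproc G f] are dominated by multiples of the mean of the [|xi_i|], hence
    integrable; this justifies removing [fine] and discarding the centered term. *)
Lemma gaussian_averageE G f : bounded_class G -> G f ->
  measurable_fun setT f -> measurable_fun setT (@gaussian_sup _ T R G n) ->
  ((gaussian_average P n G)%:E = \int[SL]_z (cproc G f z)%:E)%E.
Proof.
move=> Gb Gf mf mG.
have mS c : measurable_fun [set: n.-tuple T * n.-tuple (measurableTypeR R)]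
    (fun z => n%:R^-1 * \sum_(i < n) c * `|tnth z.2 i|).
  apply: measurable_funM => //; apply: measurable_sum => i.
  have mabs : measurable_fun [set: measurableTypeR R] (fun x => c * `|x|).
    by apply: measurable_funM => //; exact: normr_measurable.
  apply: (measurableT_comp mabs).
  exact: (measurableT_comp (@measurable_tnth _ (measurableTypeR R) n i) measurable_snd).
have S0 c (z : n.-tuple T * n.-tuple (measurableTypeR R)) : 0 <= c ->
    0 <= n%:R^-1 * \sum_(i < n) c * `|tnth z.2 i|.
  by move=> c0; rewrite mulr_ge0 ?invr_ge0// sumr_ge0// => i _; rewrite mulr_ge0.
have iS c : 0 <= c -> SL.-integrable setT
    (fun z => (n%:R^-1 * \sum_(i < n) c * `|tnth z.2 i|)%:E).
  move=> c0; apply/integrableP; split; first exact/measurable_EFinP.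
  under eq_integral do rewrite gee0_abs ?lee_fin ?S0//.
  by apply: le_lt_trans (integral_noise_sum c0) _; rewrite ltry.
have mL := @measurable_lin R d T n f mf.
have mC := measurable_cproc mf mG.
have iL : SL.-integrable setT (fun z => (lin f z)%:E).
  apply: le_integrable (iS 1 ler01) => //; first exact/measurable_EFinP.
  move=> z _; rewrite lee_fin (ger0_norm (S0 1 z ler01)).
  rewrite /lin normrM ger0_norm ?invr_ge0// ler_wpM2l ?invr_ge0//.
  apply: le_trans (ler_norm_sum _ _ _) _; apply: ler_sum => i _.
  rewrite normrM mulrC ler_wpM2r//; exact: bounded_class_norm Gb _.
have iC : SL.-integrable setT (fun z => (cproc G f z)%:E).
  apply: le_integrable (iS 2 _) => //; first exact/measurable_EFinP.
  move=> z _; rewrite lee_fin (ger0_norm (cproc_ge0 _ Gb Gf)).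
  by apply: le_trans (ler_norm _); exact: cproc_norm_le.
have L0 : (\int[SL]_z (lin f z)%:E = 0)%E.
  have := integral_lin_neg mf.
  have -> : (\int[SL]_z (- lin f z)%:E = - \int[SL]_z (lin f z)%:E)%E.
    by under eq_integral do rewrite EFinN -mulN1e; rewrite integralZl// mulN1e.
  have : (\int[SL]_z (lin f z)%:E \is a fin_num)%E by exact: integrable_fin_num.
  by move/fineK => <-; rewrite -EFinN => -[] h; congr EFin; lra.
have -> : (\int[SL]_z (cproc G f z)%:E =
    \int[SL]_z (gaussian_sup G z)%:E)%E.
  transitivity (\int[SL]_z ((cproc G f z)%:E + (lin f z)%:E))%E.
    by rewrite integralD// L0 adde0.
  by apply: eq_integral => z _; rewrite -EFinD /cproc subrK.
rewrite /gaussian_average unlock fineK//.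
have : SL.-integrable setT (fun z => (cproc G f z)%:E + (lin f z)%:E)%E.
  exact: integrableD.
move=> /(integrable_fin_num measurableT).
by under eq_integral do rewrite -EFinD /cproc subrK.
Qed.

(** The conditional Rademacher average of the class given the design. *)
Definition rad G f (x : n.-tuple T) : R :=
  savg (fun e => cproc G f (x, map_tuple sgb e)).

Lemma measurable_rad G f : measurable_fun setT f ->
  measurable_fun setT (@gaussian_sup _ T R G n) -> measurable_fun setT (rad G f).
Proof.
move=> mf mG; apply: measurable_savg => e.
exact: measurableT_comp (measurable_cproc mf mG) (measurable_pair2 _).
Qed.

Lemma rad_ge0 G f x : bounded_class G -> G f -> 0 <= rad G f x.
Proof. by move=> Gb Gf; apply: savg_ge0 => e; exact: cproc_ge0. Qed.

(** For each fixed design this is [gauss_process_ge], with the center [f] as the index of vanishing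
    coefficients; Tonelli then integrates over the design. *)
Lemma rad_le G f : bounded_class G -> G f -> measurable_fun setT f ->
  measurable_fun setT (@gaussian_sup _ T R G n) ->
  (gauss_abs%:E * \int[iid P n]_x (rad G f x)%:E <=
   \int[SL]_z (cproc G f z)%:E)%E.
Proof.
move=> Gb Gf mf mG; have g0 := @gauss_abs_gt0 R.
have mC := measurable_cproc mf mG.
have mCE : measurable_fun setT (fun z => (@cproc R d T n G f z)%:E).
  exact/measurable_EFinP.
have C0 z : (0 <= (@cproc R d T n G f z)%:E)%E by rewrite lee_fin cproc_ge0.
have mR := measurable_rad mf mG.
rewrite -ge0_integralZl//; last 3 first.
- exact/measurable_EFinP.
- by move=> x _; rewrite lee_fin rad_ge0.
- by rewrite lee_fin ltW.
rewrite (fubini_tonelli1 (m1 := iid P n) (m2 := iid gauss n) _ mCE C0).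
apply: ge0_le_integral => //.
- by move=> x _; rewrite -EFinM lee_fin mulr_ge0 ?rad_ge0// ltW.
- by apply: measurable_funeM; exact/measurable_EFinP.
- exact: measurable_fun_fubini_tonelli_F.
move=> x _; rewrite /fubini_F.
under eq_integral do rewrite cprocE//.
have bd : exists M : R, forall (k : T -> R) (i : 'I_n), G k ->
    `|n%:R^-1 * (k (tnth x i) - f (tnth x i))| <= M.
  exists (n%:R^-1 * 2) => k i Gk; rewrite normrM ger0_norm ?invr_ge0//.
  by rewrite ler_wpM2l ?invr_ge0//; exact: bounded_class_dist Gb _ _.
have := @gauss_process_ge R _ G n (fun=> 0)
  (fun g i => n%:R^-1 * (g (tnth x i) - f (tnth x i))) f Gf erefl.
move=> /(_ _ _ bd _) h; apply: le_trans (h _ _ _); last 3 first.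
- by move=> i; rewrite subrr mulr0.
- by exists 0 => k Gk; rewrite normr0.
- rewrite (_ : (fun _ => _) = (fun xi => cproc G f (x, xi))).
    exact: measurableT_comp mC (measurable_pair1 _).
  by apply/funext => xi; rewrite cprocE.
rewrite -EFinM lee_fin /rad -savgZ; apply: le_savg => e.
rewrite mulrC -ler_pdivlMr//; apply: (cproc_le Gf) => k Gk.
rewrite ler_pdivlMr//.
have [M HM] := bd.
have -> : (lin k (x, map_tuple sgb e) - lin f (x, map_tuple sgb e)) * gauss_abs =
    0 + \sum_(i < n) sgb (tnth e i) *
      (gauss_abs * (n%:R^-1 * (k (tnth x i) - f (tnth x i)))).
  rewrite add0r lin_dist mulr_sumr mulr_suml; apply: eq_bigr => i _ /=.
  by rewrite tnth_map; ring.
apply: (@isup_ub _ _ _ (fun k : T -> R => 0 + \sum_(i < n) sgb (tnth e i) *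
      (gauss_abs * (n%:R^-1 * (k (tnth x i) - f (tnth x i)))))
      (\sum_(i < n) gauss_abs * M)) => // g Gg.
rewrite add0r; apply: ler_sum => i _; apply: le_trans (ler_norm _) _.
rewrite normrM /sgb normr_sign mul1r normrM gtr0_norm// ler_wpM2l ?(ltW g0)//.
exact: HM.
Qed.

End averages.

(** * Lower bound and concentration of the global width *)

Section global_width.
Context {R : realType} {d} {T : measurableType d} (P : probability T R) (n : nat).
Hypothesis n_gt0 : (0 < n)%N.
Notation gauss := (@gauss R).
Notation SL := (pprod (iid P n) (iid gauss n)).
Notation s := (Num.sqrt n%:R : R).
Variables (F : set (T -> R)).
Hypothesis Fb : bounded_class F.

Let s_gt0 : 0 < s. Proof. by rewrite sqrtr_gt0 ltr0n. Qed.
Let s_sqr : s ^+ 2 = n%:R. Proof. by rewrite sqr_sqrtr. Qed.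

Lemma rad_ge f1 f2 x : F f1 -> F f2 ->
  (9 * s)^-1 * (n%:R^-1 * \sum_(i < n) (f1 (tnth x i) - f2 (tnth x i)) ^+ 2) <=
  rad F f1 x.
Proof.
move=> Ff1 Ff2.
pose b i := f2 (tnth x i) - f1 (tnth x i).
pose Q := \sum_(i < n) b i ^+ 2.
have QE : \sum_(i < n) (f1 (tnth x i) - f2 (tnth x i)) ^+ 2 = Q.
  by apply: eq_bigr => i _; rewrite /b -sqrrN opprB.
have Q0 : 0 <= Q by apply: sumr_ge0 => i _; exact: sqr_ge0.
have Qn : Q <= 4 * s ^+ 2.
  rewrite s_sqr mulrC -[n in n%:R]card_ord mulr_natl -sumr_const.
  apply: ler_sum => i _; rewrite -(real_normK (num_real (b i))).
  have := bounded_class_dist (tnth x i) Fb Ff2 Ff1; rewrite -/(b i).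
  by have := normr_ge0 (b i); nra.
have key : 2 * Q / (9 * s) <= savg (fun e => `|\sum_(i < n) sgb (tnth e i) * b i|).
  (* Since [Q <= 4 * s ^+ 2], the choice [t = 3 * s] makes the fourth-moment correction at most one
     third of the leading term [Q / (3 * s)]. *)
  have t0 : 0 < 3 * s by rewrite mulr_gt0.
  apply: le_trans (savg_norm_ge b t0); rewrite -/Q -subr_ge0.
  rewrite (_ : _ - _ = Q * (4 * s ^+ 2 - Q) * (36 * s ^+ 3)^-1); last first.
    by field; rewrite gt_eqF.
  by rewrite mulr_ge0 ?invr_ge0 ?mulr_ge0 ?subr_ge0// exprn_ge0// ltW.
pose cc e := cproc F f1 (x, map_tuple sgb e).
pose S e := n%:R^-1 * \sum_(i < n) sgb (tnth e i) * b i.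
have Scc e : S e <= cc e.
  rewrite (_ : S e = lin f2 (x, map_tuple sgb e) - lin f1 (x, map_tuple sgb e)).
    exact: cproc_ub.
  by rewrite lin_dist; congr (_ * _); apply: eq_bigr => i _ /=; rewrite tnth_map.
have cc0 e : 0 <= cc e by exact: cproc_ge0.
have SN e : S (map_tuple negb e) = - S e.
  rewrite /S -mulrN -sumrN; congr (_ * _); apply: eq_bigr => i _.
  by rewrite tnth_map sgbN mulNr.
(* [S] is odd in the signs and below the nonnegative [cc], so [|S e|] is covered by the values of
   [cc] at [e] and at its negation. Both average to [rad], which costs a factor 2. *)
have : savg (fun e => `|S e|) <= savg (fun e => cc e + cc (map_tuple negb e)).
  apply: le_savg => e; rewrite ler_norml; apply/andP; split.
    by have := Scc (map_tuple negb e); rewrite SN; have := cc0 e; lra.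
  by have := Scc e; have := cc0 (map_tuple negb e); lra.
rewrite savgD savg_negb -[X in _ <= X + X]/(rad F f1 x).
under eq_savg do rewrite /S normrM ger0_norm ?invr_ge0//.
rewrite savgZ QE => h; have n0 : 0 <= n%:R^-1 :> R by rewrite invr_ge0.
have := ler_wpM2l n0 key; rewrite invfM => h2.
have -> : 9^-1 / s * (n%:R^-1 * Q) = (n%:R^-1 * (2 * Q / (9 * s))) / 2.
  by field; rewrite !gt_eqF// ltr0n.
by rewrite invfM; lra.
Qed.

(** The bound of [rad_ge] is linear in the empirical squared distance, whose mean is the squared
    distance in L2(P). The 36 is its factor 9 divided by the squared separation 1/4. *)
Lemma gaussian_width_ge f1 f2 : F f1 -> F f2 ->
  measurable_fun setT f1 -> measurable_fun setT f2 ->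
  measurable_fun setT (@gaussian_sup _ T R F n) ->
  ((1 / 2)%:E <= L2norm P (f1 \- f2)%R)%E ->
  ((gauss_abs / (36 * s))%:E <= \int[SL]_z (cproc F f1 z)%:E)%E.
Proof.
move=> Ff1 Ff2 mf1 mf2 mF; rewrite le_L2norm; last by lra.
move=> f12; have g0 := @gauss_abs_gt0 R.
apply: le_trans (rad_le P Fb Ff1 mf1 mF).
rewrite EFinM lee_pmul2l//.
have msq : measurable_fun setT (fun x => (f1 x - f2 x) ^+ 2).
  by apply: measurable_funX; exact: measurable_funB.
have mS : measurable_fun setT (fun x : n.-tuple T =>
    (\sum_(i < n) (f1 (tnth x i) - f2 (tnth x i)) ^+ 2)%:E).
  apply/measurable_EFinP; apply: measurable_sum => i.
  exact: (measurableT_comp msq (@measurable_tnth _ T n i)).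
have S0 (x : n.-tuple T) :
    (0 <= (\sum_(i < n) (f1 (tnth x i) - f2 (tnth x i)) ^+ 2)%:E)%E.
  by rewrite lee_fin sumr_ge0// => i _; exact: sqr_ge0.
pose c := (9 * s)^-1 * n%:R^-1.
have c0 : 0 <= c by rewrite mulr_ge0 ?invr_ge0 ?mulr_ge0// ltW.
apply: (@le_trans _ _ (\int[iid P n]_x (c%:E *
    (\sum_(i < n) (f1 (tnth x i) - f2 (tnth x i)) ^+ 2)%:E))%E).
  rewrite ge0_integralZl//.
  rewrite (integral_iid_sum P (fun=> msq)); last by move=> i x; exact: sqr_ge0.
  apply: (@le_trans _ _ (c%:E * ((1 / 2) ^+ 2 *+ n)%:E)%E).
    rewrite -EFinM lee_fin -(mulr_natl ((1 / 2) ^+ 2)) /c.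
    rewrite le_eqVlt; apply/orP; left; apply/eqP.
    by field; rewrite !gt_eqF// ltr0n.
  rewrite lee_wpmul2l ?lee_fin// -[n in _ *+ n]card_ord -sumr_const -sumEFin.
  by apply: lee_sum => i _; exact: f12.
apply: ge0_le_integral => //.
- by move=> x _; apply: mule_ge0.
- exact: measurable_funeM.
- by apply/measurable_EFinP; exact: measurable_rad.
move=> x _; rewrite -EFinM lee_fin /c -mulrA; exact: rad_ge.
Qed.

(** Efron-Stein is applied to the blocks design and noise, and then inside each block. Changing x_i
    moves the supremum by at most [4 * |xi_i| / n]; changing xi_i from u to u' moves it by at most
    [2 * |u - u'| / n]. Each block contributes [16 * gauss_var / n]. *)
Lemma cproc_variance f0 : F f0 -> (forall f, F f -> measurable_fun setT f) ->
  measurable_fun setT (@gaussian_sup _ T R F n) ->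
  (\int[pprod SL SL]_z ((cproc F f0 z.1 - cproc F f0 z.2) ^+ 2)%:E <=
   (32 * gauss_var / n%:R)%:E)%E.
Proof.
move=> Ff0 mF mG.
have mC := measurable_cproc (mF _ Ff0) mG.
have v0 := @gauss_var_ge0 R.
have n0 : 0 <= n%:R^-1 :> R by rewrite invr_ge0.
apply: le_trans (efron_stein2 (iid P n) (iid gauss n) mC) _.
have mX : measurable_fun [set: measurableTypeR R] (fun u => u ^+ 2).
  exact: measurable_funX.
have half : (16 * gauss_var / n%:R + 16 * gauss_var / n%:R =
    32 * gauss_var / n%:R :> R) by field; rewrite gt_eqF// ltr0n.
rewrite -half EFinD; apply: leeD.
  have mE : measurable_fun setT
      (fun w : n.-tuple (measurableTypeR R) * (n.-tuple T * n.-tuple T) =>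
        ((cproc F f0 (w.2.1, w.1) - cproc F f0 (w.2.2, w.1)) ^+ 2)%:E).
    apply/measurable_EFinP/measurable_funX/measurable_funB;
      by apply: (measurableT_comp mC); apply: measurable_fun_pair => //;
        exact: measurableT_comp.
  rewrite (fubini_tonelli1 (m1 := iid gauss n) (m2 := pprod (iid P n) (iid P n)) _ mE);
    last by move=> w; rewrite lee_fin sqr_ge0.
  have mc2 : measurable_fun [set: measurableTypeR R] (fun u => (n%:R^-1 * 4) ^+ 2 * u ^+ 2).
    by apply: measurable_funM.
  apply: (@le_trans _ _ (\int[iid gauss n]_xi
      (\sum_(i < n) (n%:R^-1 * 4) ^+ 2 * (tnth xi i) ^+ 2)%:E)%E).
    apply: ge0_le_integral => //.
    - by move=> xi _; apply: integral_ge0 => w _; rewrite lee_fin sqr_ge0.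
    - apply: (measurable_fun_fubini_tonelli_F _ mE).
      by move=> w; rewrite lee_fin sqr_ge0.
    - apply/measurable_EFinP; apply: measurable_sum => i.
      exact: (measurableT_comp mc2 (@measurable_tnth _ (measurableTypeR R) n i)).
    move=> xi _; rewrite /fubini_F.
    have := @efron_stein R d T P n (fun x => cproc F f0 (x, xi))
      (fun i _ => (n%:R^-1 * 4) ^+ 2 * (tnth xi i) ^+ 2).
    have mCx : measurable_fun setT (fun x => cproc F f0 (x, xi)).
      exact: measurableT_comp mC (measurable_pair2 _).
    move=> /(_ mCx (fun=> measurable_cst _)) es; apply: le_trans (es _) _; last first.
      rewrite -sumEFin; apply: lee_sum => i _.
      by rewrite (integral_prob_cst (pprod P P)).
    move=> i x x' xx'; rewrite -exprMn -real_normK ?num_real// -[leRHS]real_normK ?num_real//.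
    rewrite ler_pXn2r ?nnegrE//; apply: cproc_dist => // g Fg.
    rewrite !lin_dist -mulrBr -sumrB (bigD1 i)//= big1 ?addr0; last first.
      by move=> j ji; rewrite xx'// subrr.
    rewrite -mulrBr !normrM -mulrA ler_wpM2l// (ger0_norm (ler0n _ 4)) mulrC.
    rewrite ler_wpM2r//.
    have := bounded_class_dist (tnth x i) Fb Fg Ff0.
    have := bounded_class_dist (tnth x' i) Fb Fg Ff0.
    by rewrite !ler_norml => /andP[? ?] /andP[? ?]; apply/andP; split; lra.
  rewrite (integral_iid_sum gauss (fun=> mc2)); last first.
    by move=> i x; rewrite mulr_ge0 ?sqr_ge0.
  have -> : (\int[gauss]_x ((n%:R^-1 * 4) ^+ 2 * x ^+ 2)%:E =
      ((n%:R^-1 * 4) ^+ 2 * gauss_var)%:E)%E.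
    under eq_integral do rewrite EFinM.
    rewrite ge0_integralZl//; first by rewrite gauss_varE.
      exact/measurable_EFinP.
    by move=> x _; rewrite lee_fin sqr_ge0.
  rewrite sumEFin sumr_const card_ord lee_fin -(mulr_natl (_ * gauss_var)).
  rewrite le_eqVlt; apply/orP; left; apply/eqP.
  by field; rewrite gt_eqF// ltr0n.
have mE : measurable_fun setT
    (fun w : n.-tuple T * (n.-tuple (measurableTypeR R) * n.-tuple (measurableTypeR R)) =>
      ((cproc F f0 (w.1, w.2.1) - cproc F f0 (w.1, w.2.2)) ^+ 2)%:E).
  apply/measurable_EFinP/measurable_funX/measurable_funB;
    by apply: (measurableT_comp mC); apply: measurable_fun_pair => //;
      exact: measurableT_comp.
rewrite (fubini_tonelli1 (m1 := iid P n) (m2 := pprod (iid gauss n) (iid gauss n)) _ mE);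
  last by move=> w; rewrite lee_fin sqr_ge0.
rewrite -[leRHS](integral_prob_cst (iid P n)).
apply: ge0_le_integral => //.
- by move=> xi _; apply: integral_ge0 => w _; rewrite lee_fin sqr_ge0.
- apply: (measurable_fun_fubini_tonelli_F _ mE).
  by move=> w; rewrite lee_fin sqr_ge0.
move=> x _; rewrite /fubini_F.
(* The 8 is 4, the square of the bound on [|g - f0|], times 2 from
   [(u - u') ^+ 2 <= 2 * (u ^+ 2 + u' ^+ 2)]. *)
pose k := 8 * (n%:R^-1) ^+ 2 : R.
have k0 : 0 <= k by rewrite mulr_ge0 ?sqr_ge0.
have mq : measurable_fun [set: measurableTypeR R * measurableTypeR R]
    (fun w => k * (w.1 ^+ 2 + w.2 ^+ 2)).
  apply: measurable_funM => //; apply: measurable_funD.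
    exact: (measurableT_comp mX measurable_fst).
  exact: (measurableT_comp mX measurable_snd).
have := @efron_stein R _ (measurableTypeR R) gauss n (fun xi => cproc F f0 (x, xi))
  (fun i w => k * (w.1 ^+ 2 + w.2 ^+ 2)).
have -> : (\int[pprod gauss gauss]_w (k * (w.1 ^+ 2 + w.2 ^+ 2))%:E =
    (k * (gauss_var + gauss_var))%:E)%E.
  have mXE : measurable_fun [set: measurableTypeR R] (fun u => (u ^+ 2)%:E).
    exact/measurable_EFinP.
  have X0 (u : R) : (0 <= (u ^+ 2)%:E)%E by rewrite lee_fin sqr_ge0.
  under eq_integral do rewrite EFinM EFinD.
  rewrite ge0_integralZl//; last 2 first.
  - apply: emeasurable_funD.
      exact: (measurableT_comp mXE measurable_fst).
    exact: (measurableT_comp mXE measurable_snd).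
  - by move=> w _; rewrite adde_ge0.
  rewrite ge0_integralD//; last 2 first.
  - exact: (measurableT_comp mXE measurable_fst).
  - exact: (measurableT_comp mXE measurable_snd).
  rewrite ((measure_preserving_fst gauss gauss).2 _ mXE X0).
  by rewrite ((measure_preserving_snd gauss gauss).2 _ mXE X0) gauss_varE.
rewrite sumEFin sumr_const card_ord.
have -> : (k * (gauss_var + gauss_var)) *+ n = 16 * gauss_var / n%:R.
  by rewrite -(mulr_natl (k * _)) /k; field; rewrite gt_eqF// ltr0n.
apply => //.
  exact: measurableT_comp mC (measurable_pair1 _).
move=> i xi xi' xx'; set u := tnth xi i; set u' := tnth xi' i.
apply: (@le_trans _ _ ((n%:R^-1 * (2 * `|u - u'|)) ^+ 2)).
  rewrite -real_normK ?num_real// ler_pXn2r ?nnegrE// ?mulr_ge0//.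
  apply: cproc_dist => // g Fg.
  rewrite !lin_dist -mulrBr -sumrB (bigD1 i)//= big1 ?addr0; last first.
    by move=> j ji; rewrite xx'// subrr.
  rewrite -mulrBl normrM ger0_norm// ler_wpM2l// normrM mulrC ler_wpM2r//.
  exact: bounded_class_dist Fb _ _.
rewrite /= !exprMn real_normK ?num_real// /k.
have := sqr_ge0 (u + u'); have := sqr_ge0 (n%:R^-1 : R).
set q := (n%:R^-1 ^+ 2 : R) => q0 uu.
rewrite -subr_ge0 (_ : _ - _ = 4 * (q * (u + u') ^+ 2)); last by ring.
by rewrite mulr_ge0// mulr_ge0.
Qed.

End global_width.

(** * The least squares estimator *)

Lemma lin_quad_le0 (R : realType) (p q : R) : 0 <= q ->
  (forall l, 0 < l <= 1 -> 2 * l * p <= l ^+ 2 * q) -> p <= 0.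
Proof.
move=> q0 h; rewrite leNgt; apply/negP => p0.
have [pq|pq] := leP q p.
  by have := h 1; rewrite ltr01 lexx => /(_ isT); lra.
have q1 : 0 < q by apply: lt_trans pq.
(* [p / q] minimizes [l ^+ 2 * q - 2 * l * p], and here it lies in the allowed range. *)
have := h (p / q); rewrite divr_gt0//= ler_pdivrMr// mul1r (ltW pq) => /(_ isT).
rewrite (_ : 2 * (p / q) * p = 2 * (p ^+ 2 / q)); last by ring.
rewrite (_ : (p / q) ^+ 2 * q = p ^+ 2 / q); last by field; rewrite gt_eqF.
have : 0 < p ^+ 2 / q by rewrite divr_gt0// exprn_gt0.
lra.
Qed.

Section ERM.
Context {R : realType} {d} {T : measurableType d} (P : probability T R) (n : nat).
Hypothesis n_gt0 : (0 < n)%N.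
Notation gauss := (@gauss R).
Notation SL := (pprod (iid P n) (iid gauss n)).
Notation Om := (n.-tuple T * n.-tuple (measurableTypeR R))%type.
Variables (F : set (T -> R)) (Psi : set (T -> R) -> (T -> R)) (f0 : T -> R).
Hypothesis F_bounded : bounded_class F.
Hypothesis F_convex : forall f g (l : R), F f -> F g -> 0 <= l <= 1 ->
  F (fun x => l * f x + (1 - l) * g x).
Hypothesis F_measurable : class_measurable F.
Hypothesis F_min : minimizers_exist F n.
Hypothesis Psi_min : selects_minimizer Psi F n.
Hypothesis erm_meas : erm_measurable Psi F n.
Hypothesis F_f0 : F f0.

Notation fhat z := (erm Psi F f0 (z : sample T R n)).

Lemma erm_argmin (z : Om) :
  argmin_rss F z.1 (response f0 (z : sample T R n)) (fhat z).
Proof. exact: Psi_min (F_min _ _). Qed.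

Lemma erm_class (z : Om) : F (fhat z).
Proof. by have [] := erm_argmin z. Qed.

Definition emp_dist (f : T -> R) (x : n.-tuple T) : R :=
  n%:R^-1 * \sum_(i < n) `|f (tnth x i) - f0 (tnth x i)|.

(** The obtuse-angle property of the projection onto a convex set: the residual of the fit is
    compared along the segment from [fhat] to [g], and the quadratic increment is handled by
    [lin_quad_le0]. *)
Lemma erm_variational (z : Om) g : F g ->
  \sum_(i < n) (tnth z.2 i - (fhat z (tnth z.1 i) - f0 (tnth z.1 i))) *
    (g (tnth z.1 i) - fhat z (tnth z.1 i)) <= 0.
Proof.
move=> Fg; have [Ff fmin] := erm_argmin z; set f := fhat z in Ff fmin *.
pose r i := tnth z.2 i - (f (tnth z.1 i) - f0 (tnth z.1 i)).
pose b i := g (tnth z.1 i) - f (tnth z.1 i).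
apply: (@lin_quad_le0 _ _ (\sum_(i < n) b i ^+ 2)).
  by apply: sumr_ge0 => i _; exact: sqr_ge0.
move=> l /andP[l0 l1].
have := fmin _ (F_convex Fg Ff (_ : 0 <= l <= 1)); rewrite (ltW l0) l1 => /(_ isT).
rewrite /rss; have E1 : \sum_(i < n) (tnth (response f0 (z : sample T R n)) i -
    f (tnth z.1 i)) ^+ 2 = \sum_(i < n) r i ^+ 2.
  by apply: eq_bigr => i _; rewrite tnth_mktuple /r; congr (_ ^+ 2); ring.
have E2 : \sum_(i < n) (tnth (response f0 (z : sample T R n)) i -
    (l * g (tnth z.1 i) + (1 - l) * f (tnth z.1 i))) ^+ 2 =
    \sum_(i < n) r i ^+ 2 - 2 * l * (\sum_(i < n) r i * b i) +
    l ^+ 2 * \sum_(i < n) b i ^+ 2.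
  rewrite !mulr_sumr -sumrB -big_split/=; apply: eq_bigr => i _.
  by rewrite tnth_mktuple /r /b; ring.
rewrite E1 E2; lra.
Qed.

Lemma erm_basic_inequality (z : Om) :
  cproc F f0 z <= (lin (fhat z) z - lin f0 z) + 2 * emp_dist (fhat z) z.1.
Proof.
apply: (cproc_le F_f0) => g Fg.
have := erm_variational z Fg; have Ff := erm_class z; set f := fhat z in Ff *.
rewrite !lin_dist /emp_dist => h.
(* The rest holds term by term. With [h = f - f0] and [g - f = (g - f0) - h], the product in the
   variational inequality contains [h ^+ 2], which has the favorable sign and is dropped, and
   [h * (g - f0)], which is at most [2 * |h|]. *)
rewrite mulrCA -mulrDr ler_wpM2l ?invr_ge0// mulr_sumr -big_split/= -subr_ge0.
rewrite -sumrB; move: h; rewrite -oppr_ge0 -sumrN => h.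
apply: le_trans h _; apply: ler_sum => i _.
set u := tnth z.1 i; set xi := tnth z.2 i.
have := bounded_class_dist u F_bounded Fg F_f0; rewrite ler_norml => /andP[h1 h2].
have := sqr_ge0 (f u - f0 u).
by case: (ger0P (f u - f0 u)) => h3 h4; nra.
Qed.

Notation sq_loss z := (loss P Psi F f0 (z : sample T R n)).

Lemma measurable_fhat_f0 (z : Om) : measurable_fun setT (fun x => fhat z x - f0 x).
Proof. by apply: measurable_funB; apply: F_measurable => //; exact: erm_class. Qed.

Let meas_sq : measurable_fun setT
  (fun zx : Om * T => ((fhat zx.1 zx.2 - f0 zx.2) ^+ 2)%:E).
Proof.
apply/measurable_EFinP/measurable_funX/measurable_funB; first exact: erm_meas.
exact: measurableT_comp (F_measurable F_f0) measurable_snd.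
Qed.

Lemma sq_lossE (z : Om) :
  (sq_loss z)%:E = (\int[P]_x ((fhat z x - f0 x) ^+ 2)%:E)%E.
Proof.
rewrite /loss /Rintegral fineK//.
have m2 : measurable_fun setT (fun x => (fhat z x - f0 x) ^+ 2).
  by apply: measurable_funX; exact: measurable_fhat_f0.
rewrite ge0_fin_numE; last by apply: integral_ge0 => x _; rewrite lee_fin sqr_ge0.
apply: (@le_lt_trans _ _ (\int[P]_x (4 : R)%:E)%E); last first.
  by rewrite integral_prob_cst ltry.
apply: ge0_le_integral => //.
- by move=> x _; rewrite lee_fin sqr_ge0.
- exact/measurable_EFinP.
move=> x _; rewrite lee_fin -real_normK ?num_real//.
have := bounded_class_dist x F_bounded (erm_class z) F_f0.
by have := normr_ge0 (fhat z x - f0 x); nra.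
Qed.

Lemma sq_loss_ge0 (z : Om) : 0 <= sq_loss z.
Proof.
have : (0 <= (sq_loss z)%:E)%E.
  by rewrite sq_lossE integral_ge0// => x _; rewrite lee_fin sqr_ge0.
by rewrite lee_fin.
Qed.

Lemma measurable_sq_loss : measurable_fun setT (fun z : Om => sq_loss z).
Proof.
apply/measurable_EFinP.
rewrite (_ : _ \o _ = fun z : Om => \int[P]_x ((fhat z x - f0 x) ^+ 2)%:E)%E; last first.
  by apply/funext => z; exact: sq_lossE.
apply: (measurable_fun_fubini_tonelli_F (m2 := P) _ meas_sq).
by move=> z; rewrite lee_fin sqr_ge0.
Qed.

Lemma sq_loss_le4 (z : Om) : sq_loss z <= 4.
Proof.
suff : ((sq_loss z)%:E <= 4%:E)%E by rewrite lee_fin.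
rewrite sq_lossE -[leRHS](integral_prob_cst P).
apply: ge0_le_integral => //.
- by move=> x _; rewrite lee_fin sqr_ge0.
- by apply/measurable_EFinP; apply: measurable_funX; exact: measurable_fhat_f0.
move=> x _; rewrite lee_fin -real_normK ?num_real//.
have := bounded_class_dist x F_bounded (erm_class z) F_f0.
by have := normr_ge0 (fhat z x - f0 x); nra.
Qed.

Lemma riskE : ((risk P Psi F f0 n)%:E = \int[SL]_z (sq_loss z)%:E)%E.
Proof.
rewrite /risk unlock fineK// ge0_fin_numE; last first.
  by apply: integral_ge0 => z _; rewrite lee_fin; exact: sq_loss_ge0.
apply: (@le_lt_trans _ _ (\int[SL]_z (4 : R)%:E)%E); last first.
  by rewrite integral_prob_cst ltry.
apply: ge0_le_integral => //.
- by move=> z _; rewrite lee_fin; exact: sq_loss_ge0.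
- by apply/measurable_EFinP; exact: measurable_sq_loss.
by move=> z _; rewrite lee_fin; exact: sq_loss_le4.
Qed.

(** Integrating [|h| <= s / 2 + h ^+ 2 / (2 * s)] at [s = r] would suffice; [s = r + e] with e
    tending to 0 covers the case [r = 0] as well. *)
Lemma L1_le_L2 (h : T -> R) (r : R) : measurable_fun setT h -> 0 <= r ->
  (\int[P]_x (h x ^+ 2)%:E <= (r ^+ 2)%:E -> \int[P]_x (`|h x|)%:E <= r%:E)%E.
Proof.
move=> mh r0 hr; apply/lee_addgt0Pr => e e0.
pose s := r + e; have s0 : 0 < s by rewrite ltr_wpDl.
have mh2 : measurable_fun setT (fun x => (h x ^+ 2)%:E).
  by apply/measurable_EFinP; exact: measurable_funX.
apply: (@le_trans _ _ (\int[P]_x ((s / 2)%:E + ((2 * s)^-1)%:E * (h x ^+ 2)%:E))%E).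
  apply: ge0_le_integral => //.
  - by apply/measurable_EFinP; exact: measurableT_comp.
  - by apply: emeasurable_funD => //; exact: measurable_funeM.
  move=> x _; rewrite -EFinM -EFinD lee_fin -(real_normK (num_real (h x))).
  set y := `|h x|; rewrite -subr_ge0.
  rewrite (_ : _ - _ = (s - y) ^+ 2 / (2 * s)); last by field; rewrite gt_eqF.
  by rewrite divr_ge0 ?sqr_ge0// mulr_ge0// ltW.
have s20 : 0 <= (2 * s)^-1 by rewrite invr_ge0 mulr_ge0// ltW.
rewrite ge0_integralD//; last 3 first.
- by move=> x _; rewrite lee_fin divr_ge0// ltW.
- by move=> x _; rewrite -EFinM lee_fin mulr_ge0 ?sqr_ge0.
- exact: measurable_funeM.
rewrite ge0_integralZl//; last by move=> x _; rewrite lee_fin sqr_ge0.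
rewrite integral_prob_cst.
apply: (@le_trans _ _ ((s / 2)%:E + ((2 * s)^-1)%:E * (r ^+ 2)%:E)%E).
  by rewrite leeD2l// lee_wpmul2l.
rewrite -EFinM -!EFinD lee_fin -/s -subr_ge0.
rewrite (_ : _ - _ = (s ^+ 2 - r ^+ 2) / (2 * s)); last by field; rewrite gt_eqF.
rewrite divr_ge0//; last by rewrite mulr_ge0// ltW.
by rewrite /s; nra.
Qed.

(** * Symmetrization of the empirical L1 distance on the event that the loss is small *)

Variable r : R.
Hypothesis r_ge0 : 0 <= r.
Notation B := (L2ball P F f0 r).
Definition good : set Om := [set z | loss P Psi F f0 (z : sample T R n) <= r ^+ 2].

Lemma measurable_good : measurable good.
Proof.
rewrite -[good]setTI (_ : good = (fun z : Om => sq_loss z) @^-1` `]-oo, r ^+ 2]); last first.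
  by apply/seteqP; split=> z; rewrite /good /= in_itv.
exact: measurable_sq_loss.
Qed.

Lemma good_ball (z : Om) : good z -> B (fhat z).
Proof.
move=> gz; split; first exact: erm_class.
by rewrite L2norm_le// -sq_lossE lee_fin.
Qed.

Lemma ball_center : B f0.
Proof.
split => //; rewrite L2norm_le// integral0_eq ?lee_fin ?sqr_ge0//.
by move=> x _ /=; rewrite subrr expr0n.
Qed.

Lemma ball_bounded : bounded_class B.
Proof. by move=> f x [Ff _]; exact: F_bounded. Qed.

Notation U e x := (sup [set 0 + \sum_(i < n) sgb (tnth e i) *
  `|n%:R^-1 * (g (tnth x i) - f0 (tnth x i))| | g in B]).

Lemma dist_bounded (x : n.-tuple T) g i : B g ->
  `|n%:R^-1 * (g (tnth x i) - f0 (tnth x i))| <= n%:R^-1 * 2.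
Proof.
move=> Bg; rewrite normrM ger0_norm ?invr_ge0// ler_wpM2l ?invr_ge0//.
exact: bounded_class_dist ball_bounded Bg ball_center.
Qed.

Lemma sup_abs_ub (e : n.-tuple bool) (x : n.-tuple T) g : B g ->
  \sum_(i < n) sgb (tnth e i) * `|n%:R^-1 * (g (tnth x i) - f0 (tnth x i))| <=
  U e x.
Proof.
move=> Bg; rewrite -[leLHS]add0r.
apply: (isup_ub (f := fun g => 0 + \sum_(i < n) sgb (tnth e i) *
  `|n%:R^-1 * (g (tnth x i) - f0 (tnth x i))|) (M := \sum_(i < n) n%:R^-1 * 2) _ Bg).
move=> k Bk; rewrite add0r; apply: ler_sum => i _; apply: le_trans (ler_norm _) _.
by rewrite normrM /sgb normr_sign mul1r normr_id; exact: dist_bounded.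
Qed.

(** This is the contraction step, carried out for a fixed design. *)
Lemma savg_sup_abs_le (x : n.-tuple T) :
  savg (fun e => U e x) <= rad B f0 x.
Proof.
have := @savg_contraction R _ B n (fun=> 0)
  (fun g i => n%:R^-1 * (g (tnth x i) - f0 (tnth x i))) f0 ball_center.
move=> h; apply: le_trans (h _ _) _.
- by exists 0 => k _; rewrite normr0.
- by exists (n%:R^-1 * 2) => k i; exact: dist_bounded.
apply: le_savg => e; rewrite cprocE//; last 2 first.
- exact: ball_bounded.
- exact: ball_center.
rewrite le_eqVlt; apply/orP; left; apply/eqP; congr sup.
apply: eq_imagel => k _; congr (_ + _); apply: eq_bigr => i _.
by rewrite tnth_map.
Qed.

(** The data [z] determining the estimator and the design [y] on which its distance is measured are
    separate arguments. The quantity of interest has [y = z.1]; the tractable one has [y]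
    independent of [z]. *)
Definition emp_good (z : Om) (y : n.-tuple T) : R :=
  \1_good z * emp_dist (fhat z) y.

Lemma emp_dist_ge0 f (y : n.-tuple T) : 0 <= emp_dist f y.
Proof. by rewrite /emp_dist mulr_ge0 ?invr_ge0// sumr_ge0. Qed.

Lemma emp_good_ge0 z y : 0 <= emp_good z y.
Proof. by rewrite mulr_ge0// emp_dist_ge0. Qed.

Lemma emp_dist_le2 f y : F f -> emp_dist f y <= 2.
Proof.
move=> Ff; rewrite /emp_dist mulrC ler_pdivrMr ?ltr0n//.
rewrite mulr_natr -[n in leRHS]card_ord -sumr_const; apply: ler_sum => i _.
exact: bounded_class_dist F_bounded Ff F_f0.
Qed.

Lemma emp_good_le2 z y : emp_good z y <= 2.
Proof.
rewrite /emp_good indicE; case: (z \in good); rewrite ?mul0r// mul1r.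
exact: emp_dist_le2 (erm_class z).
Qed.

Lemma measurable_emp_good :
  measurable_fun setT (fun zy : Om * n.-tuple T => emp_good zy.1 zy.2).
Proof.
apply: measurable_funM.
  exact: (measurableT_comp (measurable_indic measurable_good) measurable_fst).
apply: measurable_funM => //; apply: measurable_sum => i.
apply: measurableT_comp => //; apply: measurable_funB.
  have mi : measurable_fun setT (fun zy : Om * n.-tuple T => (zy.1, tnth zy.2 i)).
    apply: measurable_fun_pair => //.
    exact: (measurableT_comp (@measurable_tnth _ T n i) measurable_snd).
  exact: (measurableT_comp (erm_meas F_f0) mi).
apply: measurableT_comp (F_measurable F_f0) _.
exact: (measurableT_comp (@measurable_tnth _ T n i) measurable_snd).
Qed.

(** For fixed [e] the estimator is one function h, fitted on the mixed sample. Its empirical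
    distances on the mixed and the complementary sample differ by a sign sum over [x] and the sum
    with opposite signs over [x']. On the good event h lies in the ball, so suprema over the ball
    bound both sums although h depends on [e]; off it both distances are replaced by 0. *)
Lemma emp_good_swap_le xi (x x' : n.-tuple T) :
  savg (fun e => emp_good (tmix e x x', xi) (tmix e x x')) <=
  savg (fun e => emp_good (tmix e x x', xi) (tmix e x' x)) +
    (rad B f0 x + rad B f0 x').
Proof.
apply: (@le_trans _ _ (savg (fun e => emp_good (tmix e x x', xi) (tmix e x' x) +
    (U e x + U (map_tuple negb e) x')))); last first.
  rewrite !savgD (savg_negb (fun e => U e x')).
  by rewrite lerD2l lerD// savg_sup_abs_le.
apply: le_savg => e; rewrite /emp_good indicE.
case: (boolP (_ \in good)) => [|_]; last first.
  have U0 e' y : 0 <= U e' y.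
    apply: le_trans (sup_abs_ub e' y ball_center).
    by rewrite sumr_ge0// => i _; rewrite subrr mulr0 normr0 mulr0.
  by rewrite !mul0r add0r addr_ge0.
rewrite inE !mul1r => gz; have Bh := good_ball gz.
set h := fhat _ in Bh *.
have := sup_abs_ub e x Bh; have := sup_abs_ub (map_tuple negb e) x' Bh.
suff : emp_dist h (tmix e x x') = emp_dist h (tmix e x' x) +
  (\sum_(i < n) sgb (tnth e i) * `|n%:R^-1 * (h (tnth x i) - f0 (tnth x i))| +
   \sum_(i < n) sgb (tnth (map_tuple negb e) i) *
     `|n%:R^-1 * (h (tnth x' i) - f0 (tnth x' i))|) by lra.
rewrite /emp_dist !mulr_sumr -!big_split/=; apply: eq_bigr => i _.
rewrite !tnth_mktuple tnth_map sgbN !normrM (ger0_norm (_ : 0 <= n%:R^-1)) ?invr_ge0//.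
by case: (tnth e i); rewrite ?sgbT ?sgbF; ring.
Qed.

(** On an independent design the estimator is a fixed function, so the mean empirical distance is
    its L1(P) distance to [f0], which is at most the L2(P) distance. *)
Lemma integral_emp_good_le z : (\int[iid P n]_y (emp_good z y)%:E <= r%:E)%E.
Proof.
rewrite /emp_good indicE; case: (boolP (_ \in good)) => [|_]; last first.
  by under eq_integral do rewrite mul0r; rewrite integral_prob_cst lee_fin.
rewrite inE => gz; under eq_integral do rewrite mul1r.
have mh := measurable_fhat_f0 z.
have mah : measurable_fun setT (fun x => `|fhat z x - f0 x|).
  exact: measurableT_comp.
rewrite /emp_dist; under eq_integral do rewrite EFinM.
rewrite ge0_integralZl//; last 2 first.
- apply/measurable_EFinP; apply: measurable_sum => i.
  exact: (measurableT_comp mah (@measurable_tnth _ T n i)).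
- by move=> x _; rewrite lee_fin sumr_ge0.
rewrite (integral_iid_sum P (fun=> mah))//.
have hr : (\int[P]_x (`|fhat z x - f0 x|)%:E <= r%:E)%E.
  by apply: L1_le_L2 => //; rewrite -sq_lossE lee_fin.
apply: (@le_trans _ _ ((n%:R^-1)%:E * \sum_(i < n) r%:E)%E).
  by rewrite lee_wpmul2l ?lee_fin ?invr_ge0//; apply: lee_sum.
rewrite sumEFin sumr_const card_ord -EFinM lee_fin -(mulr_natl r) mulrA.
by rewrite mulVf ?mul1r// pnatr_eq0 -lt0n.
Qed.

Hypothesis B_meas : measurable_fun setT (@gaussian_sup _ T R B n).

(* Exchanging coordinates of the sample with those of an independent copy changes
   the selected function [fhat], but the pointwise bound [emp_good_swap_le] is
   uniform over the ball. It is applied after the finite average over all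
   exchanges, so that no supremum of unknown measurability is ever integrated. *)
Lemma integral_emp_good_diag_le :
  (\int[SL]_z (emp_good z z.1)%:E <=
   r%:E + 2%:E * \int[iid P n]_x (rad B f0 x)%:E)%E.
Proof.
have mB := measurable_rad (F_measurable F_f0) B_meas.
have mRE : measurable_fun setT (fun x : n.-tuple T => (rad B f0 x)%:E) by exact/measurable_EFinP.
have rad0 (x : n.-tuple T) : 0 <= rad B f0 x by exact: rad_ge0 ball_bounded ball_center.
have radE0 (x : n.-tuple T) : (0 <= (rad B f0 x)%:E)%E by rewrite lee_fin.
set I := (\int[iid P n]_x (rad B f0 x)%:E)%E.
have mdiag : measurable_fun setT (fun z : Om => (emp_good z z.1)%:E).
  apply/measurable_EFinP.
  have mp : measurable_fun setT (fun z : Om => (z, z.1)) by exact: measurable_fun_pair.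
  exact: (measurableT_comp measurable_emp_good mp).
rewrite (fubini_tonelli2 (m1 := iid P n) (m2 := iid gauss n) _ mdiag); last first.
  by move=> z; rewrite lee_fin emp_good_ge0.
rewrite -[leRHS](integral_prob_cst (iid gauss n)).
have I0 : (0 <= I)%E by apply: integral_ge0.
apply: ge0_le_integral => //.
- by move=> xi _; apply: integral_ge0 => x _; rewrite lee_fin emp_good_ge0.
- apply: (measurable_fun_fubini_tonelli_G _ mdiag).
  by move=> z; rewrite lee_fin emp_good_ge0.
move=> xi _; rewrite /fubini_G.
pose PP := pprod (iid P n) (iid P n).
pose al (w : n.-tuple T * n.-tuple T) := emp_good (w.1, xi) w.1.
pose be (w : n.-tuple T * n.-tuple T) := emp_good (w.1, xi) w.2.
have mwxi : measurable_fun setT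
    (fun w : n.-tuple T * n.-tuple T => (w.1, xi) : Om).
  by apply: measurable_fun_pair => //; exact: measurable_cst.
have mal : measurable_fun setT al.
  have mp : measurable_fun setT (fun w : n.-tuple T * n.-tuple T =>
      (((w.1, xi) : Om), w.1)) by exact: measurable_fun_pair.
  exact: (measurableT_comp measurable_emp_good mp).
have mbe : measurable_fun setT be.
  have mp : measurable_fun setT (fun w : n.-tuple T * n.-tuple T =>
      (((w.1, xi) : Om), w.2)) by exact: measurable_fun_pair.
  exact: (measurableT_comp measurable_emp_good mp).
have al0 w : 0 <= al w by exact: emp_good_ge0.
have be0 w : 0 <= be w by exact: emp_good_ge0.
have mx1 : measurable_fun setT (fun x : n.-tuple T => (emp_good (x, xi) x)%:E).
  apply/measurable_EFinP.
  have mp : measurable_fun setT (fun x : n.-tuple T => (((x, xi) : Om), x)).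
    by apply: measurable_fun_pair => //; exact: measurable_pair2.
  exact: (measurableT_comp measurable_emp_good mp).
rewrite -((measure_preserving_fst (iid P n) (iid P n)).2 _ mx1); last first.
  by move=> x; rewrite lee_fin emp_good_ge0.
rewrite -[leLHS]/(\int[PP]_w (al w)%:E)%E.
pose sw e (w : n.-tuple T * n.-tuple T) := (tmix e w.1 w.2, tmix e w.2 w.1).
have swP e : measure_preserving PP PP (sw e) by exact: measure_preserving_tmix.
have malE : measurable_fun setT (fun w => (al w)%:E) by exact/measurable_EFinP.
have mbeE : measurable_fun setT (fun w => (be w)%:E) by exact/measurable_EFinP.
have alE0 w : (0 <= (al w)%:E)%E by rewrite lee_fin.
have beE0 w : (0 <= (be w)%:E)%E by rewrite lee_fin.
have al_fin : (\int[PP]_w (al w)%:E)%E \is a fin_num.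
  rewrite ge0_fin_numE; last exact: integral_ge0.
  apply: (@le_lt_trans _ _ (\int[PP]_w (2 : R)%:E)%E); last first.
    by rewrite integral_prob_cst ltry.
  apply: ge0_le_integral => // w _; rewrite lee_fin; exact: emp_good_le2.
have mals e : measurable_fun setT (fun w => al (sw e w)).
  exact: measurableT_comp mal (swP e).1.
have mbes e : measurable_fun setT (fun w => be (sw e w)).
  exact: measurableT_comp mbe (swP e).1.
(* Every exchange preserves the joint law of the sample and its copy, so the integral may be
   averaged over all exchanges. *)
apply: (@le_trans _ _ (\int[PP]_w (savg (fun e => al (sw e w)))%:E)%E).
  have := @savg_le_integral R _ _ PP n (fun e w => al (sw e w))
    (fun=> fine (\int[PP]_w (al w)%:E)%E) mals (fun e w => al0 _).
  rewrite savg_cst fineK//; apply => e.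
  by rewrite ((swP e).2 (fun w => (al w)%:E)).
apply: (@le_trans _ _ (\int[PP]_w ((savg (fun e => be (sw e w)))%:E +
    ((rad B f0 w.1)%:E + (rad B f0 w.2)%:E)))%E).
  apply: ge0_le_integral => //.
  - by move=> w _; rewrite lee_fin savg_ge0.
  - by apply/measurable_EFinP; exact: measurable_savg.
  - apply: emeasurable_funD.
      by apply/measurable_EFinP; exact: measurable_savg.
    apply: emeasurable_funD.
      exact: (measurableT_comp mRE measurable_fst).
    exact: (measurableT_comp mRE measurable_snd).
  by move=> [x x'] _; rewrite -!EFinD lee_fin; exact: emp_good_swap_le.
rewrite ge0_integralD//; last 4 first.
- by move=> w _; rewrite lee_fin savg_ge0.
- by apply/measurable_EFinP; exact: measurable_savg.
- by move=> w _; rewrite adde_ge0.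
- apply: emeasurable_funD.
    exact: (measurableT_comp mRE measurable_fst).
  exact: (measurableT_comp mRE measurable_snd).
apply: leeD; last first.
  rewrite ge0_integralD//; last 2 first.
  - exact: (measurableT_comp mRE measurable_fst).
  - exact: (measurableT_comp mRE measurable_snd).
  rewrite ((measure_preserving_fst (iid P n) (iid P n)).2 _ mRE radE0).
  rewrite ((measure_preserving_snd (iid P n) (iid P n)).2 _ mRE radE0) -/I.
  by rewrite -mule2n mule_natl.
apply: integral_savg_le => // e.
(* Undoing the exchange leaves an estimator fitted on the first sample and evaluated on the
   independent second one. *)
rewrite ((swP e).2 (fun w => (be w)%:E))//.
rewrite (fubini_tonelli1 (m1 := iid P n) (m2 := iid P n) _ mbeE beE0).
rewrite -[leRHS](integral_prob_cst (iid P n)).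
apply: ge0_le_integral => //.
- by move=> x _; exact: integral_ge0.
- exact: measurable_fun_fubini_tonelli_F.
by move=> x _; exact: (integral_emp_good_le (x, xi)).
Qed.

End ERM.

(** * Localization *)

Section deviation.
Context {R : realType} {d} {A : measurableType d} (Q : probability A R).

(** Markov's inequality at level [(C * E) ^+ 2]. The level degenerates when [E = 0], but then [L]
    vanishes almost everywhere and the exceptional set is null. *)
Lemma chebyshev_sq (L : A -> R) (C E : R) :
  measurable_fun setT L -> (forall z, 0 <= L z) -> 0 < C -> 0 <= E ->
  (\int[Q]_z (L z)%:E = (E ^+ 2)%:E)%E ->
  (Q (~` [set z | (L z <= (C * E) ^+ 2)%R]) <= ((C ^+ 2)^-1)%:E)%E.
Proof.
move=> mL L0 C0 E0 LE.
have mLE : measurable_fun setT (fun z => (L z)%:E) by exact/measurable_EFinP.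
pose D := ~` [set z | L z <= (C * E) ^+ 2].
have mD : measurable D.
  apply: measurableC; rewrite -[X in measurable X]setTI.
  rewrite (_ : [set z | _] = L @^-1` `]-oo, (C * E) ^+ 2]); first exact: mL.
  by apply/seteqP; split=> z /=; rewrite in_itv.
have [E00|En0] := eqVneq E 0.
  suff -> : Q D = 0%E by rewrite lee_fin invr_ge0 sqr_ge0.
  have h0 : (\int[Q]_z `|(L z)%:E| = 0)%E.
    under eq_integral do rewrite gee0_abs ?lee_fin//.
    by rewrite LE E00 expr0n.
  have [/(_ h0) [B [mB B0 sB]] _] := ae_eq_integral_abs Q measurableT mLE.
  apply/eqP; rewrite eq_le measure_ge0 andbT -B0; apply: le_measure; rewrite ?inE//.
  move=> z Dz; apply: sB => /= /(_ I) [] Lz; apply: Dz.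
  by rewrite /= Lz sqr_ge0.
have CE0 : 0 < (C * E) ^+ 2.
  by rewrite exprn_gt0// mulr_gt0// lt_neqAle eq_sym En0.
rewrite -[leLHS]/(Q D) -(setIT D) -integral_indic//.
apply: (@le_trans _ _ (\int[Q]_z ((((C * E) ^+ 2)^-1)%:E * (L z)%:E))%E).
  apply: ge0_le_integral => //.
  - by apply/measurable_EFinP; exact: measurable_indic.
  - exact: measurable_funeM.
  move=> z _; rewrite -EFinM lee_fin indicE mulrC.
  case: (boolP (z \in D)) => [|_]; last by rewrite divr_ge0// ltW.
  by rewrite inE /D /= => /negP; rewrite -ltNge => Lz; rewrite ler_pdivlMr// mul1r ltW.
rewrite ge0_integralZl//.
- rewrite LE -EFinM lee_fin le_eqVlt; apply/orP; left; apply/eqP.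
  by field; rewrite En0 gt_eqF.
- by move=> z _; rewrite lee_fin.
- by rewrite lee_fin invr_ge0 ltW.
Qed.

(** On [D] the variable is compared with an independent copy, whose contribution factors into
    [p * W]. The fluctuation is controlled by the variance, with the weight [s] left free in place
    of the square root of Cauchy-Schwarz. *)
Lemma integral_indic_le (Z : A -> R) (D : set A) (W K p s : R) :
  measurable_fun setT Z -> (forall z, 0 <= Z z) -> measurable D -> 0 < s ->
  (\int[Q]_z (Z z)%:E = W%:E)%E -> Q D = p%:E ->
  (\int[pprod Q Q]_w ((Z w.1 - Z w.2) ^+ 2)%:E <= K%:E)%E ->
  (\int[Q]_z (\1_D z * Z z)%:E <= (p * W + s / 2 * K + p / (2 * s))%:E)%E.
Proof.
move=> mZ Z0 mD s0 ZW Dp ZK.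
have mI : measurable_fun setT (\1_D : A -> R) by exact: measurable_indic.
have I0 z : 0 <= (\1_D z : R) by rewrite indicE.
have mIE : measurable_fun setT (fun z => (\1_D z : R)%:E) by exact/measurable_EFinP.
have IE0 z : (0 <= (\1_D z : R)%:E)%E by rewrite lee_fin.
have mIZ : measurable_fun setT (fun z => (\1_D z * Z z)%:E).
  by apply/measurable_EFinP; exact: measurable_funM.
have IZ0 z : (0 <= (\1_D z * Z z)%:E)%E by rewrite lee_fin mulr_ge0.
have mcross : measurable_fun setT (fun w : A * A => (\1_D w.1 * Z w.2)%:E).
  apply/measurable_EFinP/measurable_funM.
    exact: (measurableT_comp mI measurable_fst).
  exact: (measurableT_comp mZ measurable_snd).
have cross0 (w : A * A) : (0 <= (\1_D w.1 * Z w.2)%:E)%E by rewrite lee_fin mulr_ge0.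
have msq : measurable_fun setT (fun w : A * A => ((Z w.1 - Z w.2) ^+ 2)%:E).
  by apply/measurable_EFinP/measurable_funX/measurable_funB; exact: (measurableT_comp mZ).
have sq0 (w : A * A) : (0 <= ((Z w.1 - Z w.2) ^+ 2)%:E)%E by rewrite lee_fin sqr_ge0.
have mI1 : measurable_fun setT (fun w : A * A => (\1_D w.1 : R)%:E).
  exact: (measurableT_comp mIE measurable_fst).
have s20 : 0 <= s / 2 by rewrite divr_ge0// ltW.
have s2V0 : 0 <= (2 * s)^-1 by rewrite invr_ge0 mulr_ge0// ltW.
have ID : (\int[Q]_z (\1_D z : R)%:E = p%:E)%E by rewrite integral_indic// setIT.
have crossE : (\int[pprod Q Q]_w (\1_D w.1 * Z w.2)%:E = (p * W)%:E)%E.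
  rewrite (fubini_tonelli1 (m1 := Q) (m2 := Q) _ mcross cross0) /fubini_F/=.
  under eq_integral => z _.
    under eq_integral do rewrite EFinM.
    rewrite ge0_integralZl//; last first.
    - by move=> x _; rewrite lee_fin.
    - exact/measurable_EFinP.
    rewrite ZW; over.
  have W0 : (0 <= W%:E)%E by rewrite -ZW integral_ge0// => z _; rewrite lee_fin.
  by rewrite ge0_integralZr// ID -EFinM.
rewrite -((measure_preserving_fst Q Q).2 _ mIZ IZ0).
apply: (@le_trans _ _ (\int[pprod Q Q]_w ((\1_D w.1 * Z w.2)%:E +
    ((s / 2)%:E * ((Z w.1 - Z w.2) ^+ 2)%:E + ((2 * s)^-1)%:E * (\1_D w.1)%:E)))%E).
  apply: ge0_le_integral => //.
  - exact: (measurableT_comp mIZ measurable_fst).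
  - apply: emeasurable_funD => //; apply: emeasurable_funD; exact: measurable_funeM.
  (* the weighted AM-GM inequality [|Z - Z'| <= s/2 (Z - Z')^2 + 1/(2s)] *)
  move=> w _; rewrite -!EFinM -!EFinD lee_fin indicE.
  case: (w.1 \in D); last by rewrite !mul0r add0r mulr0 addr0 mulr_ge0// sqr_ge0.
  rewrite !mul1r mulr1 -lerBlDl -subr_ge0; set y := Z w.1 - Z w.2.
  rewrite (_ : _ - _ = (s * y - 1) ^+ 2 / (2 * s)); last by field; rewrite gt_eqF.
  by rewrite mulr_ge0// sqr_ge0.
have mE1 : measurable_fun setT
    (fun w : A * A => ((s / 2)%:E * ((Z w.1 - Z w.2) ^+ 2)%:E)%E).
  exact: measurable_funeM.
have mE2 : measurable_fun setT
    (fun w : A * A => (((2 * s)^-1)%:E * (\1_D w.1)%:E)%E).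
  exact: measurable_funeM.
have E10 (w : A * A) : (0 <= (s / 2)%:E * ((Z w.1 - Z w.2) ^+ 2)%:E)%E.
  by rewrite mule_ge0.
have E20 (w : A * A) : (0 <= ((2 * s)^-1)%:E * (\1_D w.1 : R)%:E)%E.
  by rewrite mule_ge0.
rewrite ge0_integralD//; last 2 first.
- by move=> w _; rewrite adde_ge0.
- exact: emeasurable_funD.
rewrite ge0_integralD// crossE !ge0_integralZl//.
rewrite ((measure_preserving_fst Q Q).2 _ mIE IE0) ID.
rewrite !EFinD -addeA leeD2l// (EFinM (s / 2) K) leeD//.
  by rewrite lee_wpmul2l.
by rewrite -EFinM lee_fin mulrC.
Qed.

End deviation.

Lemma convex_class_comb (R : realType) (T : Type) (F : set (T -> R))
    (f g : T -> R) (l : R) :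
  convex_set (F : set (T -> R^o)) -> F f -> F g -> 0 <= l <= 1 ->
  F (fun x => l * f x + (1 - l) * g x).
Proof.
move=> cF Ff Fg /andP[l0 l1]; have := cF f g (Itv01 l0 l1).
by rewrite !inE => /(_ Ff Fg); congr F.
Qed.

Section scaling.
Context {R : realType} {d} {T : measurableType d} (P : probability T R).
Variables (F : set (T -> R)) (f0 : T -> R).
Hypothesis F_bounded : bounded_class F.
Hypothesis F_convex : forall f g (l : R), F f -> F g -> 0 <= l <= 1 ->
  F (fun x => l * f x + (1 - l) * g x).
Hypothesis F_measurable : class_measurable F.
Hypothesis F_f0 : F f0.

Lemma ball_scale (r l : R) g : 0 <= r -> 0 <= l <= 1 -> L2ball P F f0 r g ->
  L2ball P F f0 (l * r) (fun x => l * g x + (1 - l) * f0 x).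
Proof.
move=> r0 l01 [Fg]; have /andP[l0 l1] := l01.
rewrite L2norm_le// => gr; split; first exact: F_convex.
rewrite L2norm_le ?mulr_ge0//.
rewrite (eq_integral (fun x => (l ^+ 2)%:E * ((g x - f0 x) ^+ 2)%:E)%E); last first.
  by move=> x _; rewrite -EFinM; congr EFin => /=; ring.
rewrite ge0_integralZl//.
- by rewrite exprMn (EFinM (l ^+ 2) (r ^+ 2)) lee_wpmul2l// lee_fin sqr_ge0.
- by apply/measurable_EFinP/measurable_funX/measurable_funB; exact: F_measurable.
- by move=> x _; rewrite lee_fin sqr_ge0.
- by rewrite lee_fin sqr_ge0.
Qed.

(** The ball is star-shaped about [f0]: contracting g towards [f0] by the factor l stays in the
    class by convexity and multiplies the centered process by exactly l. *)
Lemma cproc_ball_scale n (r l : R) z : 0 <= r -> 0 < l <= 1 ->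
  l * @cproc R d T n (L2ball P F f0 r) f0 z <= cproc (L2ball P F f0 (l * r)) f0 z.
Proof.
move=> r0 /andP[l0 l1].
rewrite mulrC -ler_pdivlMr//.
apply: (cproc_le (ball_center P F_f0 r0)) => g Bg.
rewrite ler_pdivlMr// mulrC.
have Bg' := ball_scale r0 (_ : 0 <= l <= 1) Bg.
have -> : l * (lin g z - lin f0 z) =
    lin (fun x => l * g x + (1 - l) * f0 x) z - lin f0 z.
  rewrite !lin_dist mulrCA mulr_sumr; congr (_ * _); apply: eq_bigr => i _; ring.
apply: cproc_ub; first by move=> h x [Fh _]; exact: F_bounded.
by apply: Bg'; rewrite (ltW l0).
Qed.

End scaling.

Section localization.
Context {R : realType} {d} {T : measurableType d} (P : probability T R) (n : nat).
Hypothesis n_gt0 : (0 < n)%N.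
Variables (F : set (T -> R)) (Psi : set (T -> R) -> (T -> R)) (f0 : T -> R).
Hypothesis F_bounded : bounded_class F.
Hypothesis F_convex : forall f g (l : R), F f -> F g -> 0 <= l <= 1 ->
  F (fun x => l * f x + (1 - l) * g x).
Hypothesis F_measurable : class_measurable F.
Hypothesis F_min : minimizers_exist F n.
Hypothesis Psi_min : selects_minimizer Psi F n.
Hypothesis erm_meas : erm_measurable Psi F n.
Hypothesis F_f0 : F f0.
Hypothesis F_sup : gaussian_sup_measurable P F n.
Notation gauss := (@gauss R).
Notation m := (@gauss_abs R).
Notation SL := (pprod (iid P n) (iid gauss n)).
Notation W := (gaussian_average P n F).
Notation w r := (gaussian_average P n (L2ball P F f0 r)).

Let Br_bounded (r : R) : bounded_class (L2ball P F f0 r).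
Proof. by move=> f x [Ff _]; exact: F_bounded. Qed.

Let mf0 : measurable_fun setT f0. Proof. exact: F_measurable. Qed.

Lemma width_globalE : (W%:E = \int[SL]_z (cproc F f0 z)%:E)%E.
Proof. exact: gaussian_averageE F_bounded F_f0 mf0 F_sup.1. Qed.

Lemma width_localE (r : R) : 0 <= r ->
  ((w r)%:E = \int[SL]_z (cproc (L2ball P F f0 r) f0 z)%:E)%E.
Proof.
move=> r0; apply: gaussian_averageE => //.
- exact: ball_center.
- exact: F_sup.2.
Qed.

Let mZ : measurable_fun setT (@cproc R d T n F f0).
Proof. exact: measurable_cproc mf0 F_sup.1. Qed.

Let mZr (r : R) : 0 <= r -> measurable_fun setT (@cproc R d T n (L2ball P F f0 r) f0).
Proof. by move=> r0; apply: measurable_cproc mf0 _; exact: F_sup.2. Qed.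

Lemma width_local_ge0 (r : R) : 0 <= r -> 0 <= w r.
Proof.
move=> r0; suff : (0 <= (w r)%:E)%E by rewrite lee_fin.
rewrite width_localE// integral_ge0// => z _.
rewrite lee_fin; apply: cproc_ge0 (@Br_bounded r) _; exact: ball_center.
Qed.

Lemma width_local_le (r : R) : 0 <= r -> w r <= W.
Proof.
move=> r0; suff : ((w r)%:E <= W%:E)%E by rewrite lee_fin.
rewrite width_localE// width_globalE; apply: ge0_le_integral => //.
- move=> z _; rewrite lee_fin; apply: cproc_ge0 (@Br_bounded r) _; exact: ball_center.
- by apply/measurable_EFinP; exact: mZr.
- exact/measurable_EFinP.
move=> z _; rewrite lee_fin; apply: cproc_leS => //; first by move=> f [].
exact: ball_center.
Qed.

Lemma width_local_scale (r l : R) : 0 <= r -> 0 < l <= 1 -> l * w r <= w (l * r).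
Proof.
move=> r0 l01; have /andP[l0 l1] := l01.
have lr0 : 0 <= l * r by rewrite mulr_ge0// ltW.
suff : (l%:E * (w r)%:E <= (w (l * r))%:E)%E by rewrite -EFinM lee_fin.
have C0 z : 0 <= @cproc R d T n (L2ball P F f0 r) f0 z.
  by apply: cproc_ge0 (@Br_bounded r) _; exact: ball_center.
have mE : measurable_fun setT
    (fun z => (@cproc R d T n (L2ball P F f0 r) f0 z)%:E).
  by apply/measurable_EFinP; exact: mZr.
rewrite !width_localE// -ge0_integralZl//; last 2 first.
- by move=> z _; rewrite lee_fin.
- by rewrite lee_fin ltW.
apply: ge0_le_integral => //.
- by move=> z _; rewrite -EFinM lee_fin mulr_ge0// ltW.
- exact: measurable_funeM.
- by apply/measurable_EFinP; exact: mZr.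
by move=> z _; rewrite -EFinM lee_fin; exact: cproc_ball_scale.
Qed.

(** On the good event of radius [C * E] the basic inequality bounds the global supremum by the local
    one plus twice the empirical distance; the outer 2 comes from there, the inner 2 from the two
    samples of the symmetrization, and the division by [m] from passing from signs to Gaussians. The
    last group is the bad event. *)
Lemma localization (C E K : R) : 0 < C -> 0 <= E -> E ^+ 2 = risk P Psi F f0 n ->
  0 < W -> 32 * gauss_var / n%:R <= K ->
  W <= w (C * E) + 2 * (C * E + 2 * (w (C * E) / m)) +
    (W / C ^+ 2 + (K / (C * W) + W / C) / 2).
Proof.
move=> C0 E0 EE W0 vK; have m0 := @gauss_abs_gt0 R.
pose r := C * E; have r0 : 0 <= r by rewrite mulr_ge0// ltW.
pose B := L2ball P F f0 r; pose D := ~` @good R d T P n F Psi f0 r.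
have Bb : bounded_class B by exact: (@Br_bounded r).
have Bf0 : B f0 by exact: ball_center.
have mD : measurable D by apply: measurableC; exact: measurable_good.
have D1 : (SL D <= ((C ^+ 2)^-1)%:E)%E.
  have mL := measurable_sq_loss P F_bounded F_measurable F_min Psi_min erm_meas F_f0.
  apply: (chebyshev_sq mL) => //.
    by move=> z; exact: sq_loss_ge0.
  by rewrite EE -riskE.
pose p := fine (SL D).
have pD : SL D = p%:E by rewrite fineK// fin_num_measure.
have p0 : 0 <= p by rewrite fine_ge0.
have pC : p <= (C ^+ 2)^-1 by rewrite -lee_fin -pD.
(* With K later a multiple of [W ^+ 2], this weight makes both the variance term and the probability
   term of order [W / C]. *)
pose s := (C * W)^-1; have s0 : 0 < s by rewrite invr_gt0 mulr_gt0.
have C0z z : 0 <= @cproc R d T n F f0 z by exact: cproc_ge0.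
have bad := integral_indic_le mZ C0z mD s0 (esym width_globalE) pD
  (cproc_variance P n_gt0 F_bounded F_f0 F_measurable F_sup.1).
have emp := integral_emp_good_diag_le n_gt0 F_bounded F_measurable F_min Psi_min
  erm_meas F_f0 r0 (F_sup.2 _ _ F_f0 r0).
set I := (\int[iid P n]_x (rad B f0 x)%:E)%E in emp.
have I0 : (0 <= I)%E.
  by apply: integral_ge0 => x _; rewrite lee_fin; exact: rad_ge0.
have mI : (m%:E * I <= (w r)%:E)%E.
  by rewrite width_localE//; exact: rad_le Bb Bf0 mf0 (F_sup.2 _ _ F_f0 r0).
have IE : (I <= (w r / m)%:E)%E.
  rewrite -(@lee_pmul2l _ m%:E)// -?EFinM//.
  by rewrite mulrC divfK// gt_eqF.
have pw z : cproc F f0 z <= cproc B f0 z +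
    (2 * emp_good P F Psi f0 r z z.1 + \1_D z * cproc F f0 z).
  rewrite /emp_good !indicE /D in_setC.
  have Bz := cproc_ge0 z Bb Bf0.
  case: (boolP (z \in good P F Psi f0 r)) => [|_]; last first.
    by rewrite /= mul0r mulr0 add0r mul1r lerDr.
  rewrite inE => /(good_ball F_bounded F_measurable F_min Psi_min F_f0 r0) Bh.
  have := erm_basic_inequality F_bounded F_convex F_min Psi_min F_f0 z.
  have := @cproc_ub _ _ _ _ _ f0 _ z Bb Bh.
  by rewrite /= mul1r mul0r addr0; lra.
have mB : measurable_fun setT (fun z => (@cproc R d T n B f0 z)%:E).
  by apply/measurable_EFinP; exact: mZr.
have mG : measurable_fun setT (fun z => (@emp_good R d T P n F Psi f0 r z z.1)%:E).
  have me := measurable_emp_good P F_bounded F_measurable F_min Psi_min erm_meas F_f0 r.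
  have mp : measurable_fun setT
      (fun z : n.-tuple T * n.-tuple (measurableTypeR R) => (z, z.1)).
    exact: measurable_fun_pair.
  by apply/measurable_EFinP; exact: (measurableT_comp me mp).
have mG2 : measurable_fun setT
    (fun z => (2%:E * (@emp_good R d T P n F Psi f0 r z z.1)%:E)%E).
  exact: measurable_funeM.
have mDZ : measurable_fun setT (fun z => (\1_D z * @cproc R d T n F f0 z)%:E).
  by apply/measurable_EFinP/measurable_funM => //; exact: measurable_indic.
have B0 z : (0 <= (@cproc R d T n B f0 z)%:E)%E by rewrite lee_fin cproc_ge0.
have G0 z : (0 <= (@emp_good R d T P n F Psi f0 r z z.1)%:E)%E.
  by rewrite lee_fin emp_good_ge0.
have G20 z : (0 <= 2%:E * (@emp_good R d T P n F Psi f0 r z z.1)%:E)%E.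
  by rewrite mule_ge0.
have DZ0 z : (0 <= (\1_D z * @cproc R d T n F f0 z)%:E)%E.
  by rewrite lee_fin mulr_ge0.
have : (W%:E <= (w r)%:E + (2%:E * (r%:E + 2%:E * (w r / m)%:E) +
    (p * W + s / 2 * (32 * gauss_var / n%:R) + p / (2 * s))%:E))%E.
  rewrite width_globalE.
  apply: (@le_trans _ _ (\int[SL]_z ((cproc B f0 z)%:E +
      (2%:E * (emp_good P F Psi f0 r z z.1)%:E +
       (\1_D z * cproc F f0 z)%:E)))%E).
    apply: ge0_le_integral => //.
    - by move=> z _; rewrite lee_fin.
    - exact/measurable_EFinP.
    - by apply: emeasurable_funD => //; exact: emeasurable_funD.
    by move=> z _; rewrite -EFinM -!EFinD lee_fin; exact: pw.
  rewrite ge0_integralD//; last 2 first.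
  - by move=> z _; rewrite adde_ge0.
  - exact: emeasurable_funD.
  rewrite -width_localE// leeD2l// ge0_integralD// ge0_integralZl//.
  rewrite leeD// lee_wpmul2l//; apply: le_trans emp _.
  by rewrite leeD2l// lee_wpmul2l.
rewrite -!EFinM -!EFinD lee_fin -/r => h; apply: le_trans h _.
have h1 : p * W <= W / C ^+ 2 by rewrite mulrC ler_wpM2l// ltW.
have h2 : s / 2 * (32 * gauss_var / n%:R) <= K / (C * W) / 2.
  rewrite [leRHS]mulrAC mulrC -mulrA; rewrite /s.
  have : 0 <= (C * W)^-1 by rewrite ltW.
  set q := (C * W)^-1 => q0; rewrite [leRHS]mulrAC [leRHS]mulrC.
  by have := ler_wpM2l q0 vK; lra.
have h3 : p / (2 * s) <= W / C / 2.
  rewrite /s invfM invrK.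
  have -> : W / C / 2 = (C ^+ 2)^-1 * (2^-1 * (C * W)).
    by field; rewrite gt_eqF.
  by rewrite ler_wpM2r// mulr_ge0// mulr_ge0// ltW.
by lra.
Qed.

End localization.

(** * Absorption of the remainders and choice of the constants *)

Theorem corollary3p2 (R : realType) :
  exists c0 c1 c2 : R,
    [/\ 0 < c0 < 1, 0 < c1 < 1 & 0 < c2 < 1] /\
    forall (d : measure_display) (T : measurableType d) (P : probability T R)
      (F : set (T -> R)),
      convex_set (F : set (T -> R^o)) ->
      (forall f x, F f -> -1 <= f x <= 1) ->
      class_measurable F ->
      (exists f1 f2, [/\ F f1, F f2 &
        ((1 / 2)%:E <= L2norm P (f1 \- f2)%R)%E]) ->
      (forall n, minimizers_exist F n) ->
      (forall n, gaussian_sup_measurable P F n) ->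
      exists N : nat, forall n : nat, (N <= n)%N ->
      forall Psi : set (T -> R) -> (T -> R),
      selects_minimizer Psi F n -> erm_measurable Psi F n ->
      forall f0 : T -> R, F f0 ->
      forall E : R, 0 <= E -> E ^+ 2 = risk P Psi F f0 n ->
      E ^+ 2 <= c0 * gaussian_average P n F ^+ 2 ->
      exists t : R, [/\ 0 <= t, t <= c1 * E,
        c2 * gaussian_average P n F <= gaussian_average P n (L2ball P F f0 t) &
        gaussian_average P n (L2ball P F f0 t) <= gaussian_average P n F].
Proof.
pose m := @gauss_abs R; have m0 : 0 < m := @gauss_abs_gt0 R.
have v0 := @gauss_var_ge0 R.
(* All constants depend on the two Gaussian moments only. [K] is the variance constant 32 combined
   with the lower bound on the width: the bound on the variance becomes [K * W ^+ 2]. *)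
pose K : R := 32 * gauss_var * (36 / m) ^+ 2.
have K0 : 0 <= K by rewrite mulr_ge0 ?sqr_ge0// mulr_ge0.
(* This size of [C] makes the contribution of the bad event at most [W / 2]. *)
pose C := K + 3; have C3 : 3 <= C by rewrite lerDr.
have C0 : 0 < C by lra.
(* [M] collects the total coefficient of the local width in [localization]. *)
pose M := 1 + 4 / m; have M1 : 1 <= M by rewrite lerDl divr_ge0// ltW.
have CM : 3 <= C * M by nra.
have CC : 9 <= C ^+ 2 by nra.
(* The first constant gives [E <= W / (8 * C)], hence [2 * (C * E) <= W / 4]; with the bad event at
   most [W / 2], there remains [W / 4 <= M * w]. Shrinking the radius from [C * E] to [E / 2] costs
   the factor [2 * C], so the third constant is the inverse of [4 * M * (2 * C)]. *)
exists ((8 * C) ^+ 2)^-1, (1 / 2), (8 * C * M)^-1; split.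
  have h0 : 0 < (8 * C) ^+ 2 by rewrite exprn_gt0// mulr_gt0.
  have h2 : 0 < 8 * C * M by rewrite -mulrA; lra.
  have h1 : 1 < (8 * C) ^+ 2 by rewrite expr2; nra.
  have h3 : 1 < 8 * C * M by rewrite -mulrA; lra.
  by split; apply/andP; split; rewrite ?invr_gt0 ?invf_lt1//; lra.
move=> d T P F Fc Fb Fm [f1 [f2 [Ff1 Ff2 f12]]] Fmin Fsup.
(* The estimates hold for every positive sample size, so the threshold is 1. *)
exists 1%N => n n0 Psi Psim ermm f0 Ff0 E E0 EE EW.
pose W := gaussian_average P n F.
have Fcomb f g l := @convex_class_comb R T F f g l Fc.
have sn0 : 0 < Num.sqrt n%:R :> R by rewrite sqrtr_gt0 ltr0n.
have Wlow : m / (36 * Num.sqrt n%:R) <= W.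
  have := gaussian_width_ge n0 Fb Ff1 Ff2 (Fm _ Ff1) (Fm _ Ff2) (Fsup n).1 f12.
  by rewrite -(gaussian_averageE P Fb Ff1 (Fm _ Ff1) (Fsup n).1) lee_fin.
have W0 : 0 < W by apply: lt_le_trans Wlow; rewrite divr_gt0// mulr_gt0.
have nW : n%:R^-1 <= (36 / m) ^+ 2 * W ^+ 2.
  have -> : n%:R^-1 = (36 / m) ^+ 2 * (m / (36 * Num.sqrt n%:R)) ^+ 2 :> R.
    have := @sqr_sqrtr R n%:R (ler0n _ _); move: sn0.
    set s := Num.sqrt _ => s0 <-.
    by field; rewrite !gt_eqF.
  rewrite ler_wpM2l ?sqr_ge0// ler_pXn2r// nnegrE ltW//.
  by rewrite divr_gt0// mulr_gt0.
have vK : 32 * gauss_var / n%:R <= K * W ^+ 2.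
  by rewrite /K -[leRHS]mulrA ler_wpM2l// mulr_ge0.
have CE0 : 0 <= C * E by rewrite mulr_ge0// ltW.
have loc := localization n0 Fb Fcomb Fm (Fmin n) Psim ermm Ff0 (Fsup n) C0 E0 EE W0 vK.
have ECW : E <= W / (8 * C).
  rewrite -(@ler_pXn2r _ 2)// ?nnegrE//; last by rewrite divr_ge0 ?ltW// mulr_gt0.
  by apply: le_trans EW _; rewrite expr_div_n mulrC.
have wr0 := width_local_ge0 Fb Fm Ff0 (Fsup n) CE0.
move: loc wr0; rewrite -/m -/W; set w := gaussian_average P n _ => loc wr0.
have W4 : W / 4 <= M * w.
  have h1 : K * W ^+ 2 / (C * W) = K / C * W by field; rewrite !gt_eqF.
  have h2 : 2 * (C * E) <= W / 4.
    have := ler_wpM2l (ltW C0) ECW.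
    have -> : C * (W / (8 * C)) = W / 8 by field; rewrite gt_eqF.
    by lra.
  have h3 : W / C ^+ 2 + (K / C * W + W / C) / 2 <= W / 2.
    have -> : W / C ^+ 2 + (K / C * W + W / C) / 2 =
        W * ((2 + (K + 1) * C) / (2 * C ^+ 2)) by field; rewrite gt_eqF.
    rewrite ler_wpM2l ?(ltW W0)// ler_pdivrMr; last by rewrite mulr_gt0// exprn_gt0.
    have -> : 2^-1 * (2 * C ^+ 2) = C * C :> R by field.
    have KC : K = C - 3 by rewrite /C addrK.
    by rewrite KC; nra.
  have -> : M * w = w + 2 * (2 * (w / m)).
    by rewrite /M mulrDl mul1r; congr (_ + _); field; rewrite gt_eqF.
  by move: loc; rewrite h1; lra.
exists (E / 2); split; [by lra|by lra| |].
- have l01 : 0 < (2 * C)^-1 <= 1.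
    by rewrite invr_gt0 mulr_gt0//= invf_le1 ?mulr_gt0//; lra.
  have := width_local_scale Fb Fcomb Fm Ff0 (Fsup n) CE0 l01.
  have -> : (2 * C)^-1 * (C * E) = E / 2 by field; rewrite gt_eqF.
  apply: le_trans; rewrite -/w -/W.
  have -> : (8 * C * M)^-1 * W = (2 * C)^-1 * (W / 4 / M).
    by field; rewrite !gt_eqF//; lra.
  rewrite ler_wpM2l ?invr_ge0 ?mulr_ge0 ?(ltW C0)//.
  by rewrite ler_pdivrMr 1?mulrC//; lra.
- by apply: width_local_le => //; lra.
Qed.
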